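(* The $p$-divisible set $J(\mathbf{s}|p)$ is finite in each of the following cases (all letters $q,r,s,t,l$ denote positive integers): (1) $\mathbf{s}=(1,1)$ and $p\in\{3,7,13,31\}$, or $\mathbf{s}=(1,1,1)$ and $p=3$, or $\mathbf{s}=(1,1,2)$ and $p=7$; (2) $\mathbf{s}=(4,3,5)$ or $\mathbf{s}=(5,3,4)$, and $p=17$; (3) $\mathbf{s}=\{s\}^l$ with $1\le l\le 20$, $s\ge 2$, and $p=2$; (4) $\mathbf{s}=(s,t)$ with $s,t\le 20$, $t\ge 2$, and $p\in\{2,3,5\}$; (5) $\mathbf{s}=(r,s,t)$ with $r,s,t\le 10$, $t\ge 2$, and $p\in\{2,3,5\}$; (6) $\mathbf{s}=(q,r,s,t)$ with $q,r,s,t\le 4$, $t\ge 2$, and $p\in\{2,3,5\}$. Moreover, for every $\mathbf{s}$ occurring in cases (3), (4), (5), (6) one has $J(\mathbf{s}|2)=\{0\}$.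
   Context: For a sequence $\mathbf{s}=(s_1,\dots,s_l)$ of positive integers (of length $l$) and an integer $n\ge 0$, the multiple harmonic sum is $H(\mathbf{s};n)=\sum_{1\le k_1<\dots<k_l\le n} k_1^{-s_1}\cdots k_l^{-s_l}$; in particular $H(\mathbf{s};n)=0$ for $0\le n<l$. The notation $\{s\}^l$ means the sequence $(s,\dots,s)$ with $l$ entries. For $n\ge l$ write $H(\mathbf{s};n)=a(\mathbf{s};n)/b(\mathbf{s};n)$ in lowest terms with positive integers $a(\mathbf{s};n),b(\mathbf{s};n)$; set $a(\mathbf{s};0)=0$, $b(\mathbf{s};0)=1$. For a prime $p$, the $p$-divisible set is $J(\mathbf{s}|p)=\{0\}\cup\{n\ge l: a(\mathbf{s};n)\equiv 0 \pmod p\}$. *)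

(* Defs.v *)
From HB Require Import structures.
From mathcomp Require Import all_boot all_order all_algebra.
From mathcomp Require Import boolp classical_sets cardinality.

Set Implicit Arguments.
Unset Strict Implicit.
Unset Printing Implicit Defensive.

Import Order.TTheory GRing.Theory Num.Theory.

Local Open Scope ring_scope.

(* H(s; n): an index tuple k is 0-based, and [path ltn 0 k] says
   0 < k_1 < ... < k_l; the upper bound k_l <= n comes from the type 'I_n.+1. *)
Definition mhs (s : seq nat) (n : nat) : rat :=
  \sum_(k : (size s).-tuple 'I_n.+1
          | path ltn 0%N [seq nat_of_ord i | i <- k])
     \prod_(j < size s) (nat_of_ord (tnth k j))%:R ^- nth 0%N s j.

(* a(s; n): [numq] is the numerator of the reduced fraction with positive
   denominator [denq]. *)
Definition mhs_num (s : seq nat) (n : nat) : int := numq (mhs s n).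

Local Open Scope classical_set_scope.

(* J(s|p): the indices 1 <= n < l, at which H(s; n) = 0, are excluded. *)
Definition divisible_set (s : seq nat) (p : nat) : set nat :=
  [set 0%N] `|`
  [set n | (size s <= n)%N /\ (p%:Z %| mhs_num s n)%Z].

(* Main.v *)
Require Import Defs.
From mathcomp Require Import all_boot all_order all_algebra.
From mathcomp Require Import cyclic.
From mathcomp Require Import boolp classical_sets cardinality.
From Stdlib Require Import NArith.
From mathcomp Require Import zify ring.
Delimit Scope N_scope with num.
Delimit Scope nat_scope with N.
Delimit Scope int_scope with Z.

Set Implicit Arguments.
Unset Strict Implicit.
Unset Printing Implicit Defensive.

Import Order.TTheory GRing.Theory Num.Theory.

Local Open Scope ring_scope.

(** Let [p ^ T <= n < p ^ T.+1].  Multiplying H(s; n) by [p ^ (T |s|)], where |s| is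
    the sum of the exponents, replaces every factor [1 / k] by the weight
    [p ^ T / k], which is the inverse of the point [k / p ^ T] and is p-integral.
    If [p] divides the numerator of H(s; n), then [p ^ (T |s| + 1)] divides this
    rescaled sum.  The rescaled sum is almost constant on blocks: when [k] lies
    strictly between [M * p ^ m] and [M.+1 * p ^ m], the weight of [k] is divisible
    by [p ^ j.+1], where [j = T - m].  So at the point [M / p ^ j] its value modulo a
    suitable power of [p] can be computed for all large [T] at once: the ends of the
    blocks are known exactly, and what a block contributes in its interior is, to
    first order, a sum over a single index ([interior_sum]) that depends modulo
    [p ^ a.+1] only on [M] modulo [p ^ a] and that stops changing as [m] grows.
    Running through the points with a given error bound is a kind of p-adic ball
    arithmetic.  A string of leading digits of [n] is excluded as soon as the
    rescaled sum is a nonzero residue throughout the block that the string stands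
    for.  When a finite tree of digit strings is excluded in this way, the divisible
    set contains no [n >= p ^ D], for some [D], and it is finite.  The function
    [certify] searches for such a tree, [certifyP] says what its success proves, and
    the kernel evaluates it on each of the exponent sequences.  At the prime 2, the
    same search is run once more for each [T < D], with the blocks subdivided down to
    single integers; then no positive [n] is left at all.

    The sequences [{s}^l] with [p = 2] form an infinite family and need one more
    idea.  Collect the factors into [threshold_sum t n l], which is [2 ^ (t s l)] times
    the harmonic sum times the product of [(k / 2 ^ t) ^ s] over the multiples [k <= n]
    of [2 ^ t].  It obeys a recurrence in [n] and [l] with 2-integral coefficients,
    and modulo [2 ^ (s h.+1)] the sum with threshold [h + i] changes only at the
    multiples of [2 ^ i], so that [threshold_sum (h + i) n l] is congruent to
    [threshold_sum h (n %/ 2 ^ i) l] ([threshold_sum_congr]).  Since [i] can be chosen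
    with [l <= n %/ 2 ^ i < 2 * l], finitely many residues decide all [n]; where a
    residue vanishes, [h] is raised by one and [n %/ 2 ^ i] gets one more binary digit
    ([sweep]).  For [s >= 9] the level [h = 0] and the modulus [2 ^ 9] suffice, and
    modulo [2 ^ 9] the power [k ^ s] depends only on [s] modulo [2 ^ 8]
    ([expn_mod_periodic]), which leaves finitely many [s]. *)

(** * Divisibility of rationals by prime powers *)

Section PadicDivisibility.
Variable p : nat.
Hypothesis p_pr : prime p.

(** The p-adic valuation of [x] is at least [e]; for [e = 0] this is p-integrality.
    Congruence modulo [p ^ e] is written [pdvd e (x - y)]. *)
Definition pdvd (e : nat) (x : rat) : Prop :=
  exists a : int, exists2 b : nat, coprime p b & x * b%:R = (p ^ e)%:R * a%:~R.

Let coprime_neq0 b : coprime p b -> b%:R != 0 :> rat.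
Proof. by case: b => [|b]; rewrite ?pnatr_eq0 // /coprime gcdn0; case: p p_pr => [|[]]. Qed.

Lemma pdvd0 e : pdvd e 0.
Proof. by exists 0, 1; rewrite ?coprimen1 // mul0r mulr0. Qed.

Lemma pdvdD e x y : pdvd e x -> pdvd e y -> pdvd e (x + y).
Proof.
case=> a [b cb Hx] [c [d cd Hy]]; exists (a * d%:Z + c * b%:Z), (b * d)%N.
  by rewrite coprimeMr cb.
rewrite natrM mulrDl mulrA Hx (mulrC b%:R) mulrA Hy rmorphD !rmorphM /=; ring.
Qed.

Lemma pdvdN e x : pdvd e x -> pdvd e (- x).
Proof. by case=> a [b cb Hx]; exists (- a), b => //; rewrite mulNr Hx rmorphN mulrN. Qed.

Lemma pdvdB e x y : pdvd e x -> pdvd e y -> pdvd e (x - y).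
Proof. by move=> Hx /pdvdN; apply: pdvdD. Qed.

Lemma pdvdM e f x y : pdvd e x -> pdvd f y -> pdvd (e + f) (x * y).
Proof.
case=> a [b cb Hx] [c [d cd Hy]]; exists (a * c), (b * d)%N.
  by rewrite coprimeMr cb.
by rewrite natrM mulrACA Hx Hy expnD natrM rmorphM mulrACA.
Qed.

Lemma pdvdW e f x : (e <= f)%N -> pdvd f x -> pdvd e x.
Proof.
move=> le_ef [a [b cb Hx]]; exists ((p ^ (f - e))%:Z * a), b => //.
by rewrite Hx -{1}(subnKC le_ef) expnD natrM rmorphM -mulrA /= -pmulrn.
Qed.

Lemma pdvd_sum e (I : Type) (r : seq I) (P : pred I) (F : I -> rat) :
  (forall i, P i -> pdvd e (F i)) -> pdvd e (\sum_(i <- r | P i) F i).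
Proof. by move=> H; elim/big_ind: _ => //; [apply: pdvd0 | apply: pdvdD]. Qed.

Lemma pdvd_nat e n : (p ^ e %| n)%N -> pdvd e n%:R.
Proof.
by case/dvdnP=> k ->; exists k%:Z, 1%N; rewrite ?coprimen1 // mulr1 mulnC natrM -pmulrn.
Qed.

Lemma pdvd_int n : pdvd 0 n%:R.
Proof. by apply: pdvd_nat; rewrite expn0 dvd1n. Qed.

Lemma pdvd_natE e n : pdvd e n%:R <-> (p ^ e %| n)%N.
Proof.
split; last exact: pdvd_nat.
case=> a [b cb H]; rewrite -(Gauss_dvdl _ (coprimeXl e cb)).
have : (n * b)%N%:Z = (p ^ e)%N%:Z * a.
  by apply/eqP; rewrite -(eqr_int rat) intrM -!pmulrn natrM H.
by move/(congr1 absz); rewrite abszM !absz_nat => ->; apply: dvdn_mulr.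
Qed.

Lemma pdvd_inv u : coprime p u -> pdvd 0 u%:R^-1.
Proof.
by move=> cu; exists 1, u => //; rewrite mulVf ?coprime_neq0 // expn0 mul1r.
Qed.

Lemma pdvd_exp e x n : pdvd e x -> pdvd (e * n) (x ^+ n).
Proof.
move=> Hx; elim: n => [|n IHn]; first by rewrite muln0 expr0; apply: (pdvd_int 1).
by rewrite exprS mulnS; apply: pdvdM.
Qed.

Lemma pdvd_exp0 x n : pdvd 0 x -> pdvd 0 (x ^+ n).
Proof. by move/(pdvd_exp n). Qed.

Lemma pdvd_subX e x y n : pdvd 0 x -> pdvd 0 y -> pdvd e (x - y) -> pdvd e (x ^+ n - y ^+ n).
Proof.
move=> Hx Hy Hxy; rewrite subrXX; rewrite -[e]addn0; apply: pdvdM => //.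
by apply: pdvd_sum => i _; rewrite -[0%N]addn0; apply: pdvdM; apply: pdvd_exp0.
Qed.

Lemma pdvd_sub_mul e x y z t : pdvd 0 x -> pdvd 0 t -> pdvd e (x - y) -> pdvd e (z - t) ->
  pdvd e (x * z - y * t).
Proof.
move=> Hx Ht Hxy Hzt; have -> : x * z - y * t = x * (z - t) + (x - y) * t by ring.
by apply: pdvdD; [rewrite -[e]add0n | rewrite -[e]addn0]; apply: pdvdM.
Qed.

Lemma pdvd_trans e x y z : pdvd e (x - y) -> pdvd e (y - z) -> pdvd e (x - z).
Proof. by move=> H K; rewrite -[x](subrK y) -addrA; apply: pdvdD. Qed.

(** With a p-divisible numerator the denominator is prime to [p]. *)
Lemma pdvd_numq (x : rat) : (Posz p %| numq x)%Z -> pdvd 1 x.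
Proof.
case/dvdzP=> a Ha; exists a, `|denq x|%N.
  have := coprime_num_den x; rewrite Ha abszM coprimeMl absz_nat.
  by case/andP.
rewrite expn1 -{1}[x]divq_num_den Ha.
have -> : (`|denq x|%N)%:R = (denq x)%:~R :> rat by rewrite pmulrn gez0_abs ?denq_ge0.
by rewrite divfK ?intr_eq0 ?denq_neq0 // rmorphM /= -pmulrn mulrC.
Qed.

(** All smallness comes from here: an integer that is not divisible by [p ^ m] cancels
    fewer than [m] of the [T] factors [p]. *)
Lemma pdvd_weight T m k : (0 < k)%N -> (m <= T)%N -> ~~ (p ^ m %| k)%N ->
  pdvd (T - m).+1 ((p ^ T)%:R / k%:R).
Proof.
move=> k_gt0 le_mT ndiv; have [k' ck' Dk] := pfactor_coprime p_pr k_gt0.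
have lt_vm : (logn p k < m)%N.
  by rewrite ltnNge; apply: contra ndiv => le; rewrite pfactor_dvdn.
apply: (@pdvdW _ (T - logn p k)); first by lia.
exists 1, k' => //; rewrite mulr1 {1}Dk natrM.
have p_neq0 : (p ^ logn p k)%:R != 0 :> rat by rewrite pnatr_eq0 expn_eq0; case: p p_pr.
have -> : (p ^ T)%:R = (p ^ (T - logn p k))%:R * (p ^ logn p k)%:R :> rat.
  by rewrite -natrM -expnD subnK //; lia.
have k'_neq0 := coprime_neq0 ck'; field.
by rewrite k'_neq0 p_neq0.
Qed.

End PadicDivisibility.
(** * Multiple harmonic sums as iterated sums *)

Section IteratedSums.

(** The exponents come last index first, so that peeling off the head of the
    list removes the largest summation index. *)
Fixpoint hsum (w : nat -> rat) (sg : seq nat) (n : nat) : rat :=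
  if sg is s :: sg' then \sum_(k < n) hsum w sg' k * w k.+1 ^+ s else 1.

Lemma hsum0 w s sg : hsum w (s :: sg) 0 = 0.
Proof. by rewrite /= big_ord0. Qed.

Lemma hsumS w s sg n :
  hsum w (s :: sg) n.+1 = hsum w (s :: sg) n + hsum w sg n * w n.+1 ^+ s.
Proof. by rewrite /= big_ord_recr. Qed.

Lemma hsum_scale c sg n :
  hsum (fun k => c / k%:R) sg n = c ^+ sumn sg * hsum (fun k => k%:R^-1) sg n.
Proof.
elim: sg n => [|s sg IHsg] n /=; first by rewrite mulr1.
rewrite mulr_sumr; apply: eq_bigr => k _.
by rewrite IHsg exprMn exprD; ring.
Qed.

(** The same sums built up from the smallest index.  The tuples in [mhs] are peeled
    off at that end, whereas [hsum] recurses on the largest index. *)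
Fixpoint asc (s : seq nat) (m n : nat) : rat :=
  if s is t :: s' then \sum_(m <= k < n) k.+1%:R ^- t * asc s' k.+1 n else 1.

Lemma asc_rcons_geq s t m n : (n <= m)%N -> asc (rcons s t) m n = 0.
Proof. by move=> le_nm; case: s => [|u s]; rewrite /= big_geq. Qed.

Lemma asc_rconsS s t m n : (m <= n)%N ->
  asc (rcons s t) m n.+1 = asc (rcons s t) m n + asc s m n * n.+1%:R ^- t.
Proof.
elim: s m => [|u s IHs] m le_mn /=; first by rewrite big_nat_recr //= mulr1 mul1r.
rewrite big_nat_recr //= asc_rcons_geq // mulr0 addr0 mulr_suml -big_split /=.
rewrite [LHS]big_nat [RHS]big_nat; apply: eq_bigr => k /andP[_ lt_kn].
by rewrite IHs // mulrDr mulrA.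
Qed.

Lemma asc_rev sg n : asc (rev sg) 0 n = hsum (fun k => k%:R^-1) sg n.
Proof.
elim: sg n => [|t sg IHsg] n; first by [].
rewrite rev_cons; elim: n => [|n IHn]; first by rewrite hsum0 asc_rcons_geq.
by rewrite asc_rconsS // IHn IHsg hsumS exprVn.
Qed.

Lemma sum_tuples_asc s m n :
  \sum_(k : (size s).-tuple 'I_n.+1 | path ltn m [seq nat_of_ord i | i <- k])
     \prod_(j < size s) (nat_of_ord (tnth k j))%:R ^- nth 0%N s j = asc s m n.
Proof.
elim: s m => [|t s IHs] m /=.
  rewrite (big_pred1 [tuple]) ?big_ord0 // => k; rewrite [k]tuple0.
  by rewrite /= eqxx.
pose cons2 (x : 'I_n.+1 * (size s).-tuple 'I_n.+1) := [tuple of x.1 :: x.2].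
rewrite (reindex cons2) /=; last first.
  exists (fun k => (thead k, [tuple of behead k])) => [[x k] _|k _].
    by congr (_, _); apply/val_inj.
  by rewrite /cons2 -tuple_eta.
pose F (i : 'I_n.+1) (k : (size s).-tuple 'I_n.+1) : rat :=
  (nat_of_ord i)%:R ^- t * \prod_(j < size s) (nat_of_ord (tnth k j))%:R ^- nth 0%N s j.
pose P (i : 'I_n.+1) := (m < i)%N.
pose Q (i : 'I_n.+1) (k : (size s).-tuple 'I_n.+1) := path ltn i [seq nat_of_ord i | i <- k].
transitivity (\sum_(x | P x.1 && Q x.1 x.2) F x.1 x.2).
  apply: eq_bigr => -[x k] _ /=; rewrite big_ord_recl tnth0 /F /=; congr (_ * _).
  by apply: eq_bigr => j _; rewrite !(tnth_nth ord0) /=.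
rewrite -(pair_big_dep P Q F) /=.
transitivity (\sum_(i < n.+1 | (m < i)%N) (i : nat)%:R ^- t * asc s i n).
  by apply: eq_bigr => i _; rewrite -mulr_sumr IHs.
rewrite big_mkcond -(big_mkord xpredT (fun i => if (m < i)%N then i%:R ^- t * asc s i n else 0)).
rewrite big_nat_recl //= add0r (big_nat_widenl m 0) // [RHS]big_mkcond /=.
by apply: eq_bigr.
Qed.

Lemma mhs_hsum s n : mhs s n = hsum (fun k => k%:R^-1) (rev s) n.
Proof. by rewrite /mhs sum_tuples_asc -asc_rev revK. Qed.

End IteratedSums.

(** * The search for a certificate *)

Section Memo.
Variable A : Type.

Inductive btree := BLeaf | BNode of A & btree & btree.

Fixpoint tabulate (n : nat) (f : positive -> A) : btree :=
  if n is n'.+1 then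
    BNode (f xH) (tabulate n' (fun x => f (xO x))) (tabulate n' (fun x => f (xI x)))
  else BLeaf.

Fixpoint lookup (t : btree) (x : positive) : option A :=
  match t, x with
  | BLeaf, _ => None
  | BNode v _ _, xH => Some v
  | BNode _ l _, xO x' => lookup l x'
  | BNode _ _ r, xI x' => lookup r x'
  end.

(** The tree [t] is shared by all the calls of a partial application [memo n f]. *)
Definition memo (n : nat) (f : N -> A) : N -> A :=
  let t := tabulate n (fun x => f (Pos.pred_N x)) in
  fun x => if lookup t (N.succ_pos x) is Some v then v else f x.

Lemma lookup_tabulate n f x v : lookup (tabulate n f) x = Some v -> v = f x.
Proof. by elim: n f x => [|n IHn] f [x|x|] //= => [/IHn|/IHn|[]]. Qed.

Lemma memoE n f : memo n f =1 f.
Proof.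
move=> x; rewrite /memo; case E: (lookup _ _) => [v|//].
rewrite (lookup_tabulate E); congr f; lia.
Qed.

End Memo.

Section Algorithms.
Local Open Scope N_scope.

Definition iotaN (n : N) : seq N := [seq N.of_nat i | i <- iota 0 (N.to_nat n)].

Section UnitPowers.
Variable p : N.

Fixpoint powmod (q P : N) (s : positive) : N :=
  match s with
  | xH => q
  | xO s => let r := powmod q P s in (r * r) mod P
  | xI s => let r := powmod q P s in (((r * r) mod P) * q) mod P
  end.

(** Newton iteration for [u^-1] modulo [p ^ e]: each step doubles the precision, and
    the start modulo [p] is Fermat's inverse [u ^ (p - 2)]. *)
Fixpoint newton (fuel : nat) (u e : N) : N :=
  if fuel is f.+1 then
    if e <=? 1 then (if p - 2 is Npos k then powmod (u mod p) p k else 1) else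
    let q := newton f u (N.div2 (e + 1)) in
    let P := p ^ e in (q * (P + 2 - (u * q) mod P)) mod P
  else 0.

(** The result of [newton] is tested before it is handed out, so that nothing has to be
    proved about the iteration. *)
Definition invmod (u e : N) : option N :=
  let P := p ^ e in
  let v := u mod P in
  let q := newton 8 v e in
  if (v * q) mod P =? 1 mod P then Some q else None.

Fixpoint powers (q P x : N) (n : nat) : seq N :=
  x :: (if n is n'.+1 then powers q P ((x * q) mod P) n' else [::]).

(** Powers of [u^-1] at several precisions [e]: a request is served by the first tier
    that is precise enough, which keeps the residues short. *)
Definition unit_tiers (es : seq N) (n : nat) (u : N) : seq (N * seq N) :=
  [seq (e, if invmod u e is Some q then powers q (p ^ e) 1 n else [::]) | e <- es].

Fixpoint tier (rw : seq (N * seq N)) (e s : N) : option N :=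
  if rw is (f, qs) :: rw' then
    if e <=? f then onth qs (N.to_nat s) else tier rw' e s
  else None.

Definition unit_pow (rw : seq (N * seq N)) (u e s : N) : option N :=
  if u =? 1 then Some 1 else
  if tier rw e s is Some q then Some q else
  if invmod u e is Some q then
    Some (if s is Npos s' then powmod q (p ^ e) s' else 1)
  else None.

Definition units_for (es hi : seq N) (n bits : nat) : N -> seq (N * seq N) :=
  let b := 2 ^ N.of_nat bits in
  memo bits (fun u => if u + 1 <? b then
    unit_tiers (if u <? 32 then hi else es) n u else [::]).

End UnitPowers.

(** Approximations to [interior_sum m M s]: the entry [m] of [tab_val] is a function of
    [M] modulo [tab_mod], correct modulo the [tab_prec]-th power of the prime; the last
    entry serves for all [m >= tab_last]. *)
Record table := Table { tab_mod : N; tab_prec : N; tab_last : N; tab_val : seq (N -> N) }.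
Definition no_table : table := Table 1 0 0 [::].

Section InteriorTable.
Variables (p a s : N) (units : N -> seq (N * seq N)).
Let q := p ^ a.
Let P := p ^ (a + 1).
Let bits := N.size_nat (N.pred q).

(** The fractions with denominator exactly [p] in the unit interval after [k].  Their
    numerators [p * k + r] are units. *)
Definition first_level (k : N) : option N :=
  foldl (fun acc r =>
    if acc is Some x then
      if unit_pow p (units (p * k + r)) (p * k + r) (a + 1) s is Some v then Some (x + v) else None
    else None) (Some 0) (behead (iotaN p)).

(** The interior of a block consists of the ends of its [p] sub-blocks and of the
    interiors of these. *)
Definition next_level (first : N -> option N) (t : N -> N) (k : N) : N :=
  (odflt 0 (first k) + p ^ s * foldl (fun acc r => acc + t ((p * k + r) mod q)) 0 (iotaN p)) mod P.

(** The tables for [m = 0, 1, ...] until two successive ones agree; from there on they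
    are constant, since each one determines the next. *)
Fixpoint stabilize (fuel : nat) (first : N -> option N) (t : N -> N) : option (seq (N -> N)) :=
  if fuel is f.+1 then
    let t' := memo bits (next_level first t) in
    if all (fun k => t k =? t' k) (iotaN q) then Some [:: t] else
    if stabilize f first t' is Some ts then Some (t :: ts) else None
  else None.

Definition mk_table : table :=
  let first := memo bits first_level in
  if all (fun k => isSome (first k)) (iotaN q) then
    if stabilize 8 first (fun _ => 0) is Some ts then
      Table q (a + 1) (N.of_nat (size ts).-1) ts
    else no_table
  else no_table.

End InteriorTable.

(** A ball stands for the p-adic numbers that are congruent to [p ^ low * mant] modulo
    [p ^ prec] and divisible by [p ^ low].  The exponent [low] may exceed what the other
    two fields imply. *)
Record ball := Ball { mant : N; prec : N; low : N }.
(** What is known of a sum along the interior of a block: [bany] bounds its change from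
    the left end to any interior point.  Its change over the whole interior is [bctr]
    times the value of the next shorter sum at the left end (and a power of [p]), up to
    an error that [berr] bounds; [bany] and [berr] are exponents of [p]. *)
Record bound := Bound { bany : N; berr : N; bctr : N }.
Definition ball0 := Ball 0 0 0.
(** Stands for infinity among exponents. *)
Definition far : N := 1000.
Definition bound0 := Bound far far 0.

(** With [exact = false] the search covers all [T >= cap]; with [exact = true] it covers
    [T = cap] only, and a block of depth [cap] is then a single integer. *)
Record data := Data {
  radix : N; cap : N; exact : bool; units : N -> seq (N * seq N);
  tables : seq table; rpow : N -> N }.

Section Search.
Variable E : data.
Let p := radix E.
Let D := cap E.

Definition at_bottom (j : N) : bool := exact E && (j =? D).

(** The contribution of a single index in the interior of a block, with its precision.
    Unless [T] is known, the table must already be constant at level [D - j]. *)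
Definition single (j M s : N) : N * N :=
  let t := nth no_table (tables E) (N.to_nat s) in
  let m := D - j in
  if exact E || (tab_last t <=? m) then
    (nth (fun _ => 0) (tab_val t) (N.to_nat (N.min m (tab_last t)))
       (if M <? tab_mod t then M else M mod tab_mod t), tab_prec t)
  else (0, 0).

(** Either one index of the sum lies in the interior, which the table accounts for, or
    at least two do, and then the change of the shorter sum brings in a second small
    factor; this is the term [b]. *)
Fixpoint interior (K j M : N) (sg : seq N) (st : seq ball) : seq bound :=
  match sg, st with
  | s :: sg', _ :: st' =>
    let bs := interior K j M sg' st' in
    let js := (j + 1) * s in
    let a := low (head ball0 st') + js in
    let b := bany (head bound0 bs) + js in
    let c := N.min a b in
    (if K <=? a then Bound c c 0 else
     let: (t, g) := single j M s in Bound c (N.min (a + g) b) t) :: bs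
  | _, _ => [:: bound0]
  end.

Definition bounds (K j M : N) (sg : seq N) (st : seq ball) : seq bound :=
  if at_bottom j then bound0 :: [seq bound0 | _ <- sg] else interior K j M sg st.

(** The shortcuts avoid arithmetic on the very frequent trivial cases. *)
Definition shift (m d : N) : N :=
  if d =? 0 then m else if m =? 0 then 0 else rpow E d * m.

(** From the left end of a block to the right end, for all the tails of [sg] together:
    first over the interior, giving [z], then over the right end, whose weight is
    [p ^ d / u].  The term of the right end is computed modulo [p ^ K]. *)
Fixpoint advance (K j d u : N) (rw : seq (N * seq N)) (sg : seq N) (st : seq ball)
    (bs : seq bound) : seq ball * ball :=
  match sg, st, bs with
  | s :: sg', x :: st', b :: bs' =>
    let: (new, y) := advance K j d u rw sg' st' bs' in
    let x1 := head ball0 st' in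
    let js := (j + 1) * s in
    let a := low x1 + js in
    let w2 := N.min (low x) (bany b) in
    let k2 := N.min (prec x) (berr b) in
    let z := if bctr b =? 0 then Ball (shift (mant x) (low x - w2)) k2 w2
      else Ball (shift (mant x) (low x - w2) + shift (mant x1 * bctr b) (a - w2))
             (N.min k2 (prec x1 + js)) w2 in
    let wc := low y + d * s in
    let w3 := N.min w2 wc in
    let m2 := shift (mant z) (w2 - w3) in
    let: (m3, k3) :=
      if K <=? wc then (m2, N.min (prec z) wc) else
      if mant y =? 0 then (m2, N.min (prec z) (prec y + d * s)) else
      if unit_pow p rw u (K - wc) s is Some q then
        (m2 + shift (mant y * q) (wc - w3), N.min K (N.min (prec z) (prec y + d * s)))
      else (m2, N.min (prec z) wc) in
    (Ball m3 k3 w3 :: new, z)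
  | _, _, _ => (st, head ball0 st)
  end.

Definition cross (K j M d u : N) (sg : seq N) (st : seq ball) (bs : seq bound) : seq ball :=
  (advance K j d u (units E u) sg st bs).1.

Fixpoint strip (fuel : nat) (m w : N) : N * N :=
  if fuel is f.+1 then
    let: (q, r) := N.div_eucl m p in if r =? 0 then strip f q (w + 1) else (m, w)
  else (m, w).

Definition normalize (x : ball) : ball :=
  if prec x <=? low x then Ball 0 (prec x) (low x) else
  let m := mant x mod rpow E (prec x - low x) in
  if m =? 0 then Ball 0 (prec x) (prec x) else
  let: (m', w) := strip (N.to_nat (prec x)) m (low x) in
  if w <=? prec x then Ball m' (prec x) w else Ball m (prec x) (low x).

(** A refinement policy: would the error made on this block spoil the target precision
    [K] of the complete sum?  An error in a shorter sum gains the weights of the indices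
    that are still to come, at least [f]: they lie either in the present block, with
    exponent [g], or behind it, as estimated in [tail]. *)
Fixpoint too_coarse (K g f : N) (sg tail : seq N) (bs : seq bound) : bool :=
  if bs is b :: bs' then
    (berr b + f <? K) ||
    match sg, tail with
    | s :: sg', f' :: tail' => too_coarse K g (N.min f' (f + g * s)) sg' tail' bs'
    | _, _ => false
    end
  else false.

(** Crosses the block after [M / p ^ j], in one stroke if that is precise enough and
    else through its [p] sub-blocks.  The right end of the last sub-block is the right
    end of the block, and so has the same weight [p ^ d / u]. *)
Fixpoint walk (fuel : nat) (K : N) (sg tail : seq N) (j M g u d : N) (st : seq ball) : seq ball :=
  let bs := bounds K j M sg st in
  if fuel is f.+1 then
    if too_coarse K g 0 sg (behead tail) bs then
      map normalize (foldl (fun st r =>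
        let M' := p * M + r in
        if r + 1 <? p then walk f K sg tail (j + 1) M' (N.min g (j + 1)) (M' + 1) (j + 1) st
        else walk f K sg tail (j + 1) M' (if g <=? j then g else j + 2) u d st)
        st (iotaN p))
    else cross K j M d u sg st bs
  else cross K j M d u sg st bs.

(** In a list of costs, the entry of a tail of [sg] estimates by how many powers of [p]
    an error in this tail is multiplied before it reaches the complete sum.  In a gap of
    depth [d] several indices may be placed, hence the minimum [z] is passed on; a
    point takes one index only, hence [y] is passed on. *)
Fixpoint relax_gap (d : N) (sg c : seq N) (x : N) : seq N :=
  match sg, c with
  | s :: sg', y :: c' => let z := N.min y (x + d * s) in z :: relax_gap d sg' c' z
  | _, _ => [::]
  end.

Fixpoint relax_point (d : N) (sg c : seq N) (x : N) : seq N :=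
  match sg, c with
  | s :: sg', y :: c' => N.min y (x + d * s) :: relax_point d sg' c' y
  | _, _ => [::]
  end.

Fixpoint relax_points (n : nat) (d : N) (sg c : seq N) : seq N :=
  if n is n'.+1 then
    let c' := relax_point d sg c 0 in
    if n' is 0%N then c' else relax_points n' d sg (relax_gap (d + 1) sg c' 0)
  else c.

(** The costs of [n0] points at depth [d0] with the gaps between them, followed by
    blocks whose interior has depth [d2]. *)
Definition tail_costs (sg : seq N) (d0 n0 d2 : N) : seq N :=
  relax_points (N.to_nat (N.min n0 (N.of_nat (size sg)))) d0 sg
    (relax_gap d2 sg [seq far | _ <- sg] 0).

(** Writes [k / p ^ j] as a unit over [p ^ d]. *)
Fixpoint unit_part (fuel : nat) (k j : N) : N * N :=
  if fuel is f.+1 then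
    let: (q, r) := N.div_eucl k p in if r =? 0 then unit_part f q (j - 1) else (k, j)
  else (k, j).

Definition go (K : N) (sg : seq N) (j M n0 d2 : N) (st : seq ball) : seq ball :=
  let: (u, d) := unit_part (N.to_nat j) (M + 1) j in
  walk (N.to_nat (D - j)) K sg (0 :: tail_costs sg j n0 d2) j M (j + 1) u d st.

(** Of a block: no [n] in it belongs to the divisible set, or it has to be subdivided,
    or more precision is needed, or more precision will not help. *)
Inductive verdict := Dead | Alive | Unknown | Stuck.

(** On the block, the rescaled sum equals its value at the left end up to [p ^ c], and it
    is a multiple of [p ^ (D |s| + 1)] if [n] belongs to the divisible set. *)
Definition status (K j M : N) (sg : seq N) (st : seq ball) : verdict :=
  let x := head ball0 st in
  let c := bany (head bound0 (bounds 0 j M sg st)) in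
  let e := N.min (N.min (prec x) c) (D * foldr N.add 0 sg + 1) in
  if (low x <? e) && ~~ (mant x mod rpow E (e - low x) =? 0) then Dead else
  if at_bottom j then (if M <? N.of_nat (size sg) then Dead else Unknown)
  else if c <=? prec x then Alive else if prec x <? K then Stuck else Unknown.

Fixpoint next_nonzero (ds : seq N) (j : N) : N :=
  if ds is d :: ds' then if d =? 0 then next_nonzero ds' (j + 1) else j else far.

Fixpoint steps (n : nat) (K : N) (sg : seq N) (j M d2 : N) (st : seq ball) : seq ball :=
  if n is n'.+1 then steps n' K sg j (M + 1) d2 (go K sg j M (N.of_nat n) d2 st) else st.

(** Walks from the origin to the point whose base [p] digits are [ds].  The digit [last]
    is the furthest that will be needed at the next depth. *)
Fixpoint descend (K : N) (sg ds : seq N) (last j M : N) (st : seq ball) : N * seq ball :=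
  if ds is d :: ds' then
    descend K sg ds' last (j + 1) (p * M + d)
      (steps (N.to_nat d) K sg j (p * M) (next_nonzero (rcons ds' last) (j + 1)) st)
  else (M, st).

Fixpoint children (n : nat) (K : N) (sg : seq N) (j M : N) (st : seq ball) : seq verdict :=
  status K j M sg st ::
  (if n is n'.+1 then children n' K sg j (M + 1) (go K sg j M (N.of_nat n) far st) else [::]).

(** Decides which of the digits in [pend] may follow [ds], raising the precision for the
    undecided ones; the walk then starts again from the origin. *)
Fixpoint settle (fuel : nat) (K : N) (sg ds pend alive : seq N) : option (seq N) :=
  if pend is [::] then Some alive else
  if fuel is f.+1 then
    let last := foldl N.max 0 pend in
    let: (M, st) := descend K sg ds last 0 0 (rcons [seq Ball 0 K K | _ <- sg] (Ball 1 K 0)) in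
    let vs := children (N.to_nat last) K sg (N.of_nat (size ds)) (p * M) st in
    let verdict r := nth Unknown vs (N.to_nat r) in
    if has (fun r => if verdict r is Stuck then true else false) pend then None else
    settle f (K + N.max 2 (K / 5)) sg ds
      [seq r <- pend | if verdict r is Unknown then true else false]
      ([seq r <- pend | if verdict r is Alive then true else false] ++ alive)
  else None.

(** A guess at the exponent of [p] in the rescaled sum near [ds], plus a few digits. *)
Definition initial_precision (sg ds : seq N) : N :=
  let full := rcons ds (p - 1) in
  let d0 := next_nonzero full 0 in
  let d2 := next_nonzero (drop (N.to_nat d0).+1 full) (d0 + 1) in
  foldl (fun f x => N.min x.1 (f + (d0 + 1) * x.2)) 0
    (zip (tail_costs sg d0 (nth 0 full (N.to_nat d0)) d2) sg) + 4.

(** Explores the tree of digit strings; the first digit is not zero. *)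
Fixpoint expand (fuel : nat) (sg ds : seq N) : bool :=
  if fuel is f.+1 then
    let pend := if ds is [::] then behead (iotaN p) else iotaN p in
    if settle 9 (initial_precision sg ds) sg ds pend [::] is Some al then
      all (fun r => expand f sg (rcons ds r)) al
    else false
  else false.

Definition certify (sg : seq N) : bool := expand (N.to_nat D).+1 sg [::].

End Search.

(** The dummy in front makes an exponent the position of its table. *)
Definition tables_for (p : N) (units : N -> seq (N * seq N)) (n : nat) (a : N -> N) : seq table :=
  no_table :: [seq (let s := N.of_nat i in mk_table p (a s) s units) | i <- iota 1 n].

End Algorithms.

(** * Correctness of the modular arithmetic *)

Section BinaryNaturals.

Lemma to_natD a b : N.to_nat (a + b)%num = (N.to_nat a + N.to_nat b)%N.
Proof. lia. Qed.

Lemma to_natM a b : N.to_nat (a * b)%num = (N.to_nat a * N.to_nat b)%N.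
Proof. lia. Qed.

Lemma to_natX a b : N.to_nat (a ^ b)%num = (N.to_nat a ^ N.to_nat b)%N.
Proof.
elim/N.peano_ind: b => [|b IHb]; first by rewrite N.pow_0_r.
by rewrite N.pow_succ_r' N2Nat.inj_succ expnS to_natM IHb.
Qed.

Lemma to_nat_min a b : N.to_nat (N.min a b) = minn (N.to_nat a) (N.to_nat b).
Proof. lia. Qed.

Lemma to_natB a b : N.to_nat (a - b)%num = (N.to_nat a - N.to_nat b)%N.
Proof. lia. Qed.

Lemma to_nat_mod a b : (0 < N.to_nat b)%N -> N.to_nat (a mod b)%num = (N.to_nat a %% N.to_nat b)%N.
Proof.
move=> b_gt0; have lt : (N.to_nat (a mod b)%num < N.to_nat b)%N.
  have: (a mod b < b)%num by apply: N.mod_lt; lia.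
  lia.
rewrite {2}[a](N.div_mod' a b) to_natD to_natM mulnC modnMDl modn_small //.
Qed.

Lemma behead_iotaN n : behead (iotaN n) = [seq N.of_nat i | i <- iota 1 (N.to_nat n).-1].
Proof. by rewrite /iotaN; case: (N.to_nat n). Qed.

Lemma mem_iotaN r n : (r \in iotaN n) = (N.to_nat r < N.to_nat n)%N.
Proof.
apply/mapP/idP => [[i]|lt_rn]; first by rewrite mem_iota => /andP[_ lt] ->; lia.
by exists (N.to_nat r); rewrite ?mem_iota //; lia.
Qed.

Lemma foldl_iotaN (S : Type) (f : S -> N -> S) (inv : nat -> S -> Prop) x n :
  inv 0%N x ->
  (forall i y, (i < N.to_nat n)%N -> inv i y -> inv i.+1 (f y (N.of_nat i))) ->
  inv (N.to_nat n) (foldl f x (iotaN n)).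
Proof.
rewrite /iotaN => inv0; elim: (N.to_nat n) => [|k IHk] invS //.
rewrite -addn1 iotaD map_cat foldl_cat /= add0n addn1; apply: (invS) => //.
by apply: IHk => i y lt_ik; apply: invS; apply: ltnW.
Qed.

End BinaryNaturals.

Local Notation "n %:rat" := ((N.to_nat n)%:R : rat) (at level 2, left associativity, format "n %:rat").

Section UnitPowersCorrect.
Variable p : N.
Hypothesis p_pr : prime (N.to_nat p).
Local Notation pdvd := (pdvd (N.to_nat p)).

Lemma pdvd_mod e x y : (N.to_nat p ^ e %| N.to_nat y)%N -> pdvd e (x%:rat - (x mod y)%num%:rat).
Proof.
move=> dv; rewrite {1}[x](N.div_mod' x y) to_natD natrD addrK.
by apply: pdvd_nat; rewrite to_natM dvdn_mulr.
Qed.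

Lemma pdvd_modX e x : pdvd (N.to_nat e) (x%:rat - (x mod p ^ e)%num%:rat).
Proof. by apply: pdvd_mod; rewrite to_natX. Qed.

Lemma pdvd_modX' e x z : pdvd (N.to_nat e) (z - x%:rat) ->
  pdvd (N.to_nat e) (z - (x mod p ^ e)%num%:rat).
Proof. by move=> H; apply: (pdvd_trans H); apply: pdvd_modX. Qed.

(** If [u r = 1] modulo [p ^ e], then [u^-1 - r = u^-1 (1 - u r)] is small. *)
Lemma invmodP u e q : coprime (N.to_nat p) (N.to_nat u) -> invmod p u e = Some q ->
  pdvd (N.to_nat e) (u%:rat^-1 - q%:rat).
Proof.
move=> cu; rewrite /invmod; case: ifP; last by [].
move=> /N.eqb_eq Hq /Some_inj <-.
set r := newton _ _ _ _ in Hq *; have u0 : u%:rat != 0.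
  rewrite pnatr_eq0; apply: contraTneq cu => ->; rewrite /coprime gcdn0.
  by case: (N.to_nat p) p_pr => [|[]].
have -> : u%:rat^-1 - r%:rat = u%:rat^-1 * (1 - u%:rat * r%:rat) by field.
rewrite -[N.to_nat e]add0n; apply: pdvdM; first exact: pdvd_inv.
have H1 := pdvd_modX e 1; rewrite -Hq in H1.
apply: (pdvd_trans H1); rewrite -opprB; apply: pdvdN.
apply: (@pdvd_trans _ _ _ ((u mod p ^ e)%num * r)%num%:rat).
  rewrite to_natM natrM -mulrBl -[N.to_nat e]addn0; apply: pdvdM; last exact: pdvd_int.
  exact: pdvd_modX.
exact: pdvd_modX.
Qed.

Lemma powersP e x q n i y :
  onth (powers q (p ^ e) x n) i = Some y ->
  pdvd (N.to_nat e) (x%:rat * q%:rat ^+ i - y%:rat).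
Proof.
elim: n x i => [|n IHn] x [|i] /=; rewrite ?onth0n //;
  try by case=> <-; rewrite expr0 mulr1 subrr; apply: pdvd0.
move/IHn => H; apply: (pdvd_trans _ H).
rewrite exprS mulrA -mulrBl -[N.to_nat e]addn0; apply: pdvdM; last first.
  by apply: pdvd_exp0 => //; apply: pdvd_int.
by rewrite -natrM -to_natM; apply: pdvd_modX.
Qed.

Lemma powmodP e q s :
  pdvd (N.to_nat e) (q%:rat ^+ Pos.to_nat s - (powmod q (p ^ e) s)%:rat).
Proof.
have sq x y : pdvd (N.to_nat e) (x - y%:rat) -> pdvd 0 x ->
    pdvd (N.to_nat e) (x ^+ 2 - ((y * y) mod p ^ e)%num%:rat).
  move=> H Hx; apply: pdvd_modX'; rewrite to_natM natrM -expr2.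
  by apply: pdvd_subX => //; apply: pdvd_int.
have Hq n : pdvd 0 (q%:rat ^+ n) by apply: pdvd_exp0 => //; apply: pdvd_int.
elim: s => [s IHs|s IHs|] /=; last first.
- by rewrite expr1 subrr; apply: pdvd0.
- have -> : Pos.to_nat (xO s) = (Pos.to_nat s * 2)%N by lia.
  by rewrite exprM; apply: sq.
have -> : Pos.to_nat (xI s) = (Pos.to_nat s * 2).+1 by lia.
rewrite exprS mulrC exprM.
apply: pdvd_modX'; rewrite to_natM natrM -mulrBl -[N.to_nat e]addn0.
by apply: pdvdM; [exact: sq | exact: pdvd_int].
Qed.

Definition units_ok (units : N -> seq (N * seq N)) : Prop :=
  forall u e s y, coprime (N.to_nat p) (N.to_nat u) -> tier (units u) e s = Some y ->
  pdvd (N.to_nat e) (u%:rat ^- N.to_nat s - y%:rat).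

Lemma units_forP es hi n bits : units_ok (units_for p es hi n bits).
Proof.
move=> u e s y cu; rewrite /units_for memoE; case: ifP => // _.
set l := (if _ then _ else _); elim: l => //= f l IHl.
case: N.leb_spec => // le_ef; case Eq: (invmod _ _ _) => [q|]; last by rewrite onth0n.
move=> Hy; apply: (@pdvdW _ _ (N.to_nat f)); first lia.
apply: (pdvd_trans _ _); last by have := powersP Hy; apply.
rewrite mul1r -exprVn; apply: pdvd_subX; [exact: pdvd_inv | exact: pdvd_int |].
exact: invmodP.
Qed.

Lemma unit_powP units u e s y : units_ok units -> coprime (N.to_nat p) (N.to_nat u) ->
  unit_pow p (units u) u e s = Some y ->
  pdvd (N.to_nat e) (u%:rat ^- N.to_nat s - y%:rat).
Proof.
move=> ok cu; rewrite /unit_pow; case: N.eqb_spec => [->|_].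
  by case=> <-; rewrite expr1n invr1 subrr; apply: pdvd0.
case Et: (tier _ _ _) => [x|]; first by case=> <-; apply: ok Et.
case Ei: (invmod _ _ _) => [q|] // [<-].
case: s {Et} => [|s] /=; first by rewrite invr1 subrr; apply: pdvd0.
apply: (pdvd_trans _ (powmodP e q s)).
rewrite -exprVn; apply: pdvd_subX; [exact: pdvd_inv | exact: pdvd_int |].
exact: invmodP.
Qed.

End UnitPowersCorrect.

(** * Rescaled sums inside a block *)

Section ScaledSums.
Variable p : nat.
Hypothesis p_pr : prime p.
Local Notation pdvd := (pdvd p).

Definition weight (T k : nat) : rat := (p ^ T)%:R / k%:R.

Let p_neq0 e : (p ^ e)%:R != 0 :> rat.
Proof. by rewrite pnatr_eq0 expn_eq0; case: p p_pr. Qed.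

Lemma hsum_shift w s sg n0 i :
  hsum w (s :: sg) (n0 + i) = hsum w (s :: sg) n0
    + \sum_(k < i) hsum w sg (n0 + k) * w (n0 + k).+1 ^+ s.
Proof. by rewrite /= big_split_ord. Qed.

(** Strictly inside a block of length [p ^ m] there is no multiple of [p ^ m]. *)
Lemma weight_interior j m M i : (i.+1 < p ^ m)%N ->
  pdvd j.+1 (weight (j + m) (M * p ^ m + i).+1).
Proof.
move=> lt_i; have := @pdvd_weight p p_pr (j + m) m (M * p ^ m + i).+1 isT.
rewrite addnK leq_addl; apply => //; rewrite -addnS dvdn_addr ?dvdn_mull //.
by rewrite gtnNdvd.
Qed.

(** The sum of [x ^ -s] over the fractions [x] strictly between [M] and [M.+1] whose
    denominator divides [p ^ m], with the common factor [p ^ s] taken out. *)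
Definition interior_sum (m M s : nat) : rat :=
  \sum_(i < (p ^ m).-1) ((p ^ m)%:R / (p * (M * p ^ m + i.+1))%:R) ^+ s.

Lemma sum_weight_interior j m M s :
  \sum_(i < (p ^ m).-1) weight (j + m) (M * p ^ m + i).+1 ^+ s
  = (p ^ (j.+1 * s))%:R * interior_sum m M s.
Proof.
rewrite mulr_sumr; apply: eq_bigr => i _.
rewrite expnM natrX -exprMn; congr (_ ^+ _).
rewrite /weight expnD expnS addnS !natrM.
have H1 : ((M * p ^ m + i).+1)%:R != 0 :> rat by rewrite pnatr_eq0.
have := p_neq0 1; rewrite expn1 => H2.
move: (_.+1%:R) H1 => x Hx; field; by rewrite Hx H2.
Qed.

(** Multiplying by [p] maps the fractions in the interval after [M] with denominator
    dividing [p ^ m.+1] onto those with denominator dividing [p ^ m] in the [p] intervals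
    after [p * M + r], for [r < p], and onto the integers that separate these. *)
Lemma interior_sumS m M s :
  interior_sum m.+1 M s = \sum_(1 <= r < p) (p * M + r)%:R ^- s
    + (p ^ s)%:R * \sum_(r < p) interior_sum m (p * M + r) s.
Proof.
pose q := (p ^ m)%N; have q_gt0 : (0 < q)%N by rewrite expn_gt0 prime_gt0.
pose f k : rat := (q%:R / (M * p ^ m.+1 + k)%:R) ^+ s.
(* The sum over [a] blocks of length [q], block by block; the case [a = p] is used. *)
have blocks a : \sum_(0 <= k < a * q) f k = \sum_(0 <= r < a) \sum_(0 <= v < q) f (r * q + v)%N.
  elim: a => [|a IHa]; first by rewrite mul0n !big_geq.
  rewrite big_nat_recr //= -IHa mulSnr (big_cat_nat (leq0n (a * q))) ?leq_addr //=.
  by rewrite -{2}[(a * q)%N]add0n big_addn addKn; congr (_ + _); apply: eq_bigr => v _; rewrite addnC.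
have p_gt0 := prime_gt0 p_pr.
have pqE : (p ^ m.+1 = p * q)%N by rewrite expnS.
have Dp : p%:R != 0 :> rat by rewrite pnatr_eq0 -lt0n.
have Dq : q%:R != 0 :> rat by rewrite pnatr_eq0 -lt0n.
have -> : interior_sum m.+1 M s = \sum_(1 <= k < p * q) f k.
  rewrite /interior_sum -(big_mkord xpredT (fun i => ((p ^ m.+1)%:R / (p * (M * p ^ m.+1 + i.+1))%:R) ^+ s)).
  rewrite big_add1 pqE; apply: eq_bigr => i _; rewrite /f; congr (_ ^+ _).
  rewrite pqE !natrM; have : (M * (p * q) + i.+1)%:R != 0 :> rat by rewrite addnS pnatr_eq0.
  by move: (_%:R) => x Hx; field; rewrite Hx Dp.
have := blocks p; rewrite [in LHS]big_ltn ?muln_gt0 ?p_gt0 //.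
rewrite [X in _ = X -> _]big_ltn // [X in _ = X + _ -> _]big_ltn // mul0n add0n -addrA => /addrI ->.
(* The terms strictly inside a sub-block; those with [v = 0] are its left end. *)
have inner r : (\sum_(1 <= v < q) f (r * q + v)%N) = (p ^ s)%:R * interior_sum m (p * M + r) s.
  rewrite /interior_sum -(big_mkord xpredT (fun i => ((p ^ m)%:R / (p * ((p * M + r) * p ^ m + i.+1))%:R) ^+ s)).
  rewrite big_add1 mulr_sumr; apply: eq_bigr => i _; rewrite /f natrX -exprMn; congr (_ ^+ _).
  rewrite -/q pqE; have -> : (M * (p * q) + (r * q + i.+1) = (p * M + r) * q + i.+1)%N by ring.
  rewrite [(p * _)%:R]natrM; have : ((p * M + r) * q + i.+1)%:R != 0 :> rat by rewrite addnS pnatr_eq0.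
  by move: (_%:R) => x Hx; field; rewrite Hx Dp.
rewrite -(big_mkord xpredT (fun r => interior_sum m (p * M + r) s)).
rewrite [in RHS]big_ltn // mulrDr.
have -> : \sum_(1 <= v < q) f v = (p ^ s)%:R * interior_sum m (p * M + 0) s.
  by rewrite -inner; apply: eq_bigr => v _; rewrite mul0n add0n.
rewrite addrCA; congr (_ + _); rewrite mulr_sumr -big_split /=.
rewrite [LHS]big_nat [RHS]big_nat; apply: eq_bigr => r /andP[r_gt0 _].
rewrite big_ltn // addn0 inner; congr (_ + _).
rewrite /f -exprVn pqE; congr (_ ^+ _).
have -> : (M * (p * q) + r * q = q * (p * M + r))%N by ring.
rewrite natrM; have : (p * M + r)%:R != 0 :> rat by rewrite pnatr_eq0; lia.
by move: (_%:R) => x Hx; field; rewrite Hx Dq.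
Qed.

Lemma interior_sum0 M s : interior_sum 0 M s = 0.
Proof. by rewrite /interior_sum big_ord0. Qed.

Lemma interior_sum_int m M s : pdvd 0 (interior_sum m M s).
Proof.
elim: m M => [|m IHm] M; first by rewrite interior_sum0; apply: pdvd0.
rewrite interior_sumS; apply: pdvdD => //; last first.
  by rewrite -[0%N]addn0; apply: pdvdM; [exact: pdvd_int | apply: pdvd_sum].
rewrite big_nat; apply: pdvd_sum => // r /andP[r_gt0 lt_rp].
rewrite -exprVn; apply: pdvd_exp0 => //; apply: pdvd_inv => //.
by rewrite /coprime mulnC gcdnMDl; move: (prime_coprime r p_pr); rewrite gtnNdvd.
Qed.

End ScaledSums.

(** * Correctness of the tables *)
Definition table_ok (p s : nat) (t : table) : Prop := forall m M,
  pdvd p (N.to_nat (tab_prec t))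
    (interior_sum p m M s - (nth (fun _ => 0%num) (tab_val t) (minn m (N.to_nat (tab_last t)))
                              (N.of_nat M mod tab_mod t)%num)%:rat).

Section TableCorrect.
Variables (p a s : N) (units : N -> seq (N * seq N)).
Hypothesis p_pr : prime (N.to_nat p).
Hypothesis units_p : units_ok p units.
Local Notation P := (N.to_nat p).
Local Notation pdvd := (pdvd P).
Let e := N.to_nat (a + 1).
Let q := (p ^ a)%num.

Let p_gt0 : (0 < P)%N. Proof. exact: prime_gt0. Qed.
Let qE : N.to_nat q = (P ^ N.to_nat a)%N. Proof. exact: to_natX. Qed.
Let q_gt0 : (0 < N.to_nat q)%N. Proof. by rewrite qE expn_gt0 p_gt0. Qed.
Let eE : e = (N.to_nat a).+1. Proof. by rewrite /e; lia. Qed.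

Let coprime_child (k : nat) (r : nat) : (0 < r < P)%N -> coprime P (P * k + r)%N.
Proof.
case/andP=> r_gt0 lt_rp; rewrite /coprime mulnC gcdnMDl.
by move: (prime_coprime r p_pr); rewrite gtnNdvd.
Qed.

Lemma first_levelP k b : first_level p a s units k = Some b ->
  pdvd e (\sum_(1 <= r < P) (P * N.to_nat k + r)%:R ^- N.to_nat s - b%:rat).
Proof.
have -> : \sum_(1 <= r < P) (P * N.to_nat k + r)%:R ^- N.to_nat s
    = \sum_(r <- behead (iotaN p)) (p * k + r)%num%:rat ^- N.to_nat s.
  rewrite behead_iotaN big_map /index_iota subn1; apply: eq_bigr => r _.
  by rewrite to_natD to_natM Nat2N.id.
rewrite /first_level.
have : {in behead (iotaN p), forall r, (0 < N.to_nat r < P)%N}.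
  move=> r; rewrite behead_iotaN => /mapP[i]; rewrite mem_iota => /andP[i_gt0 lt_i] ->.
  by rewrite Nat2N.id i_gt0; lia.
elim/last_ind: (behead _) b => [|l r IHl] b l_lt /=.
  by case=> <-; rewrite big_nil subrr => //; apply: pdvd0.
rewrite -cats1 foldl_cat /= big_cat big_seq1 /=.
case El: (foldl _ _ _) => [x|] //; case Eu: (unit_pow _ _ _ _ _) => [v|] // [<-].
rewrite (to_natD x v) natrD opprD addrACA; apply: pdvdD.
  by apply: IHl => // z lz; apply: l_lt; rewrite mem_rcons inE lz orbT.
have := l_lt r; rewrite mem_rcons inE eqxx => /(_ isT) lt_r.
by apply: unit_powP Eu => //; rewrite to_natD to_natM; apply: coprime_child.
Qed.

Let sum_foldl (F : N -> N) :
  (foldl (fun acc r => (acc + F r)%num) 0%num (iotaN p))%:rat = \sum_(r < P) (F (N.of_nat r))%:rat.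
Proof.
apply: (@foldl_iotaN _ _ (fun i y => y%:rat = \sum_(r < i) (F (N.of_nat r))%:rat)).
  by rewrite big_ord0.
by move=> i y _ Hy; rewrite to_natD natrD Hy big_ord_recr.
Qed.

Definition level_ok (m : nat) (t : N -> N) : Prop :=
  forall M, pdvd e (interior_sum P m M (N.to_nat s) - (t (N.of_nat M mod q)%num)%:rat).

Let modqE M : N.to_nat (N.of_nat M mod q) = (M %% N.to_nat q)%N.
Proof. by rewrite to_nat_mod // Nat2N.id. Qed.

(** Modulo [p ^ a.+1] the units [p * M + r] depend on [M] modulo [p ^ a] only, and so do
    the arguments [p * M + r], modulo [p ^ a], of the previous table. *)
Lemma next_levelP first m t : (forall k, (N.to_nat k < N.to_nat q)%N -> isSome (first k)) ->
  first =1 first_level p a s units ->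
  level_ok m t -> level_ok m.+1 (next_level p a s first t).
Proof.
move=> some_first Efirst okt M; set k := (N.of_nat M mod q)%num.
have ltkq : (N.to_nat k < N.to_nat q)%N by rewrite modqE ltn_mod.
have [c DM] : exists c, M = (c * N.to_nat q + N.to_nat k)%N.
  by exists (M %/ N.to_nat q)%N; rewrite modqE -divn_eq.
rewrite interior_sumS // /next_level; have := some_first k ltkq.
case Ef: (first k) => [b|] //= _; rewrite Efirst in Ef.
apply: pdvd_modX'; rewrite -/e (to_natD b) natrD opprD addrACA; apply: pdvdD.
  apply: (pdvd_trans _ (first_levelP Ef)).
  rewrite -sumrB big_nat; apply: pdvd_sum => r lt_r.
  rewrite -!exprVn; have cu := coprime_child M lt_r; have cv := coprime_child (N.to_nat k) lt_r.
  apply: pdvd_subX => //; try exact: pdvd_inv.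
  have -> : (P * M + r)%:R^-1 - (P * N.to_nat k + r)%:R^-1 =
     - (P * (c * N.to_nat q))%:R * ((P * M + r)%:R^-1 * (P * N.to_nat k + r)%:R^-1) :> rat.
    have -> : (P * M + r)%:R = (P * (c * N.to_nat q))%:R + (P * N.to_nat k + r)%:R :> rat.
      by rewrite -natrD {1}DM; congr _%:R; ring.
    have H1 : (P * N.to_nat k + r)%:R != 0 :> rat by rewrite pnatr_eq0; lia.
    have : (P * (c * N.to_nat q))%:R + (P * N.to_nat k + r)%:R != 0 :> rat.
      by rewrite -natrD pnatr_eq0; lia.
    by move: (_%:R) (_%:R) H1 => x y Hy Hxy; field; rewrite Hy Hxy.
  rewrite -[e]addn0; apply: pdvdM; last by rewrite -[0%N]addn0; apply: pdvdM; exact: pdvd_inv.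
  by apply: pdvdN; apply: pdvd_nat; rewrite eE expnS dvdn_mul // qE dvdn_mull.
rewrite to_natM natrM to_natX -mulrBr -[e]add0n; apply: pdvdM; first exact: pdvd_int.
rewrite sum_foldl -sumrB; apply: pdvd_sum => r _.
have -> : ((p * k + N.of_nat r) mod q)%num = (N.of_nat (P * M + r) mod q)%num.
  apply: N2Nat.inj; rewrite modqE to_nat_mod // to_natD to_natM Nat2N.id.
  by rewrite modqE -modnDml modnMmr modnDml.
exact: okt.
Qed.

Lemma level_ok_eq m t t' : (forall k, (N.to_nat k < N.to_nat q)%N -> t k = t' k) ->
  level_ok m t -> level_ok m t'.
Proof.
move=> Et okt M; rewrite -Et; first exact: okt.
by rewrite modqE ltn_mod.
Qed.

(** Once the table [t] of level [m] agrees with the next one, induction shows that it is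
    correct at all later levels. *)
Lemma stabilizeP fuel first m0 t ts :
  (forall k, (N.to_nat k < N.to_nat q)%N -> isSome (first k)) ->
  first =1 first_level p a s units ->
  level_ok m0 t -> stabilize p a s fuel first t = Some ts ->
  (0 < size ts)%N /\ forall m, level_ok (m0 + m) (nth (fun _ => 0%num) ts (minn m (size ts).-1)).
Proof.
move=> some_first Efirst; elim: fuel m0 t ts => [|fuel IHf] m0 t ts okt //=.
have oknext m u : level_ok m u -> level_ok m.+1 (memo (N.size_nat (N.pred q)) (next_level p a s first u)).
  move=> oku; apply: (@level_ok_eq _ (next_level p a s first u)); first by move=> k _; rewrite memoE.
  exact: next_levelP.
case: allP => [Et [<-]|_].
  split=> // m; rewrite minn0 /=; elim: m => [|m IHm]; first by rewrite addn0.
  rewrite addnS; apply: (level_ok_eq _ (oknext _ _ IHm)) => k ltk.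
  by apply/esym/N.eqb_eq; apply: Et; rewrite mem_iotaN.
case Es: (stabilize _ _ _ _ _ _) => [us|] // [<-].
have [us_gt0 okus] := IHf _ _ _ (oknext _ _ okt) Es; split=> // -[|m].
  by rewrite min0n addn0.
rewrite addnS -addSn /=; have := okus m; congr (level_ok _ _).
by rewrite -{2}(prednK us_gt0) minnSS.
Qed.

Lemma mk_tableP : table_ok P (N.to_nat s) (mk_table p a s units).
Proof.
have no_tableP : table_ok P (N.to_nat s) no_table.
  move=> m M /=; apply: pdvdB; last exact: pdvd0.
  exact: interior_sum_int.
rewrite /mk_table; case: allP => // some_first.
case Es: (stabilize _ _ _ _ _ _) => [ts|] //.
have [] := @stabilizeP _ _ 0 _ _ _ _ _ Es.
- by move=> k ltk; apply: some_first; rewrite mem_iotaN.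
- exact: memoE.
- by move=> M; rewrite interior_sum0 subrr; apply: pdvd0.
by move=> _ H m M; have := H m M; rewrite add0n /= Nat2N.id.
Qed.

End TableCorrect.

Lemma tables_forP p units n a : prime (N.to_nat p) -> units_ok p units ->
  forall s, table_ok (N.to_nat p) s (nth no_table (tables_for p units n a) s).
Proof.
move=> p_pr ok; have no_tableP s : table_ok (N.to_nat p) s no_table.
  move=> m M /=; apply: pdvdB; last exact: pdvd0.
  exact: interior_sum_int.
case=> [|s] //=; have [lt_sn|le_ns] := ltnP s n; last by rewrite nth_default ?size_map ?size_iota.
rewrite (nth_map 0%N) ?size_iota // nth_iota // add1n.
by rewrite -{1}[s.+1]Nat2N.id; apply: mk_tableP.
Qed.

(** * Correctness of the search *)

Section SearchCorrect.
Variable E : data.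
Let p := radix E.
Let D := cap E.
Local Notation P := (N.to_nat p).
Local Notation pdvd := (pdvd P).
Hypothesis p_pr : prime P.
Hypothesis units_E : units_ok p (units E).
Hypothesis tables_E : forall s, table_ok P s (nth no_table (tables E) s).
Hypothesis rpow_E : forall c, rpow E c = (p ^ c)%num.

Variable T : nat.
Hypothesis le_DT : (N.to_nat D <= T)%N.
Hypothesis exact_T : exact E -> T = N.to_nat D.

Let P_gt0 : (0 < P)%N. Proof. exact: prime_gt0. Qed.
Let P_neq0 e : (P ^ e)%:R != 0 :> rat.
Proof. by rewrite pnatr_eq0 expn_eq0 negb_and -lt0n P_gt0. Qed.

Definition scaled_sum (sg : seq N) (n : nat) : rat := hsum (weight P T) [seq N.to_nat s | s <- sg] n.

Definition in_ball (x : rat) (b : ball) : Prop :=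
  pdvd (N.to_nat (prec b)) (x - (P ^ N.to_nat (low b))%:R * (mant b)%:rat)
  /\ pdvd (N.to_nat (low b)) x.

(** A state is a list of balls, one for each tail of [sg]; the last one belongs to the
    empty sum, which is 1. *)
Fixpoint state_ok (n : nat) (sg : seq N) (st : seq ball) : Prop :=
  match sg, st with
  | [::], [:: b] => in_ball (scaled_sum [::] n) b
  | _ :: sg', b :: st' => in_ball (scaled_sum sg n) b /\ state_ok n sg' st'
  | _, _ => False
  end.

Lemma state_ok_head n sg st : state_ok n sg st -> in_ball (scaled_sum sg n) (head ball0 st).
Proof. by case: sg st => [|s sg] [|b [|c st]] //= []. Qed.

(** The entries of [bs] describe the interior of the block of length [q] after [n0], for
    each nonempty tail of [sg]; the point [n0 + q.-1] is the last one before the right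
    end. *)
Fixpoint bounds_ok (n0 q j : nat) (sg : seq N) (st : seq ball) (bs : seq bound) : Prop :=
  match sg, st, bs with
  | [::], _, b :: _ => True
  | s :: sg', _ :: st', b :: bs' =>
    [/\ forall i, (i < q)%N -> pdvd (N.to_nat (bany b)) (scaled_sum sg (n0 + i) - scaled_sum sg n0),
        pdvd (N.to_nat (berr b)) (scaled_sum sg (n0 + q.-1) - scaled_sum sg n0
           - scaled_sum sg' n0 * (P ^ (j.+1 * N.to_nat s))%:R * (bctr b)%:rat),
        bctr b = 0%num \/ (N.to_nat (bany b) <= N.to_nat (low (head ball0 st')) + j.+1 * N.to_nat s)%N
      & bounds_ok n0 q j sg' st' bs']
  | _, _, _ => False
  end.

Lemma bounds_ok_any n0 q j sg st bs i : bounds_ok n0 q j sg st bs -> (i < q)%N ->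
  pdvd (N.to_nat (bany (head bound0 bs))) (scaled_sum sg (n0 + i) - scaled_sum sg n0).
Proof.
case: sg st bs => [|s sg] [|b st] [|c bs] //=; try by move=> *; rewrite subrr; apply: pdvd0.
by case=> H _ _ _ /H.
Qed.

(** The change of a sum is split according to whether the shorter sum in front of the
    last index is taken at the left end of the block or as its change since then. *)
Let scaled_sum_shift s sg n0 i : scaled_sum (s :: sg) (n0 + i) - scaled_sum (s :: sg) n0 =
  scaled_sum sg n0 * (\sum_(k < i) weight P T (n0 + k).+1 ^+ N.to_nat s)
  + \sum_(k < i) (scaled_sum sg (n0 + k) - scaled_sum sg n0) * weight P T (n0 + k).+1 ^+ N.to_nat s.
Proof.
rewrite /scaled_sum [map _ _]/= hsum_shift addrAC subrr add0r mulr_sumr -big_split /=.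
by apply: eq_bigr => k _; ring.
Qed.

(** The first part of [scaled_sum_shift] is the tabulated [interior_sum]; the second is
    a product of two quantities that are small on the block. *)
Lemma boundsP K j M sg st :
  (N.to_nat j <= N.to_nat D)%N ->
  let m := (T - N.to_nat j)%N in let n0 := (N.to_nat M * P ^ m)%N in
  state_ok n0 sg st -> bounds_ok n0 (P ^ m) (N.to_nat j) sg st (bounds E K j M sg st).
Proof.
move=> le_jD m n0; have TE : T = (N.to_nat j + m)%N by rewrite /m; lia.
rewrite /bounds; case: ifP => [|_].
  case/andP=> exE /N.eqb_eq jD; have m0 : m = 0%N by rewrite /m exact_T // jD; lia.
  suff : forall bs, state_ok n0 sg st -> size bs = (size sg).+1 -> all (fun b => bctr b == 0%num) bs ->
      bounds_ok n0 (P ^ m) (N.to_nat j) sg st bs.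
    by move=> H ok; apply: H => //=; rewrite ?size_map //; elim: (sg).
  elim: sg st => [|s sg IHsg] [|b st] [|c bs] //= [_ okst'] [sz] /andP[/eqP c0 cs].
  have q1 : (P ^ m)%N = 1%N by rewrite m0.
  split; [| | by left | exact: IHsg].
    by move=> [|i]; rewrite q1 // addn0 subrr => _; apply: pdvd0.
  by rewrite q1 addn0 subrr c0 mulr0 subrr; apply: pdvd0.
elim: sg st => [|s sg IHsg] [|b st] //= [inb okst'].
have := IHsg _ okst'; set bs := interior _ _ _ _ _ _ => okbs.
have [_ lowx1] := state_ok_head okst'; set x1 := head ball0 st in lowx1 *.
set js := ((j + 1) * s)%num; have jsE : N.to_nat js = ((N.to_nat j).+1 * N.to_nat s)%N.
  by rewrite /js; lia.
have wk i : (i.+1 < P ^ m)%N -> pdvd (N.to_nat js) (weight P T (n0 + i).+1 ^+ N.to_nat s).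
  by move=> lt_i; rewrite jsE; apply: pdvd_exp => //; rewrite TE; apply: weight_interior.
have Hrest i : (i < P ^ m)%N -> pdvd (N.to_nat (bany (head bound0 bs)) + N.to_nat js)
   (\sum_(k < i) (scaled_sum sg (n0 + k) - scaled_sum sg n0) * weight P T (n0 + k).+1 ^+ N.to_nat s).
  move=> lt_i; apply: pdvd_sum => k _; apply: pdvdM.
    by apply: bounds_ok_any okbs _; apply: ltn_trans lt_i.
  by apply: wk; apply: leq_ltn_trans lt_i.
have Hfirst i : (i < P ^ m)%N -> pdvd (N.to_nat (low x1) + N.to_nat js)
   (scaled_sum sg n0 * \sum_(k < i) weight P T (n0 + k).+1 ^+ N.to_nat s).
  move=> lt_i; apply: pdvdM => //; apply: pdvd_sum => k _.
  by apply: wk; apply: leq_ltn_trans lt_i.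
set c := N.min (low x1 + js)%num (bany (head bound0 bs) + js)%num.
have Hc i : (i < P ^ m)%N -> pdvd (N.to_nat c) (scaled_sum (s :: sg) (n0 + i) - scaled_sum (s :: sg) n0).
  move=> lt_i; rewrite scaled_sum_shift; apply: pdvdD.
    by apply: pdvdW (Hfirst i lt_i); rewrite /c; lia.
  by apply: pdvdW (Hrest i lt_i); rewrite /c; lia.
have lt_q : ((P ^ m).-1 < P ^ m)%N by rewrite prednK // expn_gt0 P_gt0.
case: ifP => _.
  by split=> //=; [rewrite mulr0 subr0; apply: Hc | left].
case Es: (single E j M s) => [t g] /=; split=> //=; last by right; rewrite /c; lia.
rewrite scaled_sum_shift addrAC; apply: pdvdD; last by apply: pdvdW (Hrest _ lt_q); lia.
rewrite -mulrA -mulrBr; apply: (@pdvdW _ _ (N.to_nat (low x1) + (N.to_nat js + N.to_nat g))); first lia.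
apply: pdvdM => //; rewrite TE sum_weight_interior // -jsE -mulrBr.
apply: pdvdM; first by apply: pdvd_nat.
move: Es; rewrite /single; set tb := nth no_table _ _ => /=.
case: ifP => [cond|_] [<- <-]; last first.
  by apply: pdvdB; [exact: interior_sum_int | exact: pdvd0].
have -> : (if (M <? tab_mod tb)%num then M else M mod tab_mod tb)%num = (M mod tab_mod tb)%num.
  by case: N.ltb_spec => // lt; rewrite N.mod_small.
have -> : N.to_nat (N.min (cap E - j) (tab_last tb)) = minn m (N.to_nat (tab_last tb)).
  rewrite to_nat_min to_natB -/D; case/orP: cond => [exE|/N.leb_le].
    by rewrite /m exact_T.
  by rewrite -/D /m; lia.
by rewrite -{2}[M]N2Nat.id; apply: tables_E.
Qed.

(** Rewrites a mantissa for a smaller [low]. *)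
Lemma shiftP m w w2 : (N.to_nat w2 <= N.to_nat w)%N ->
  (P ^ N.to_nat w2)%:R * (shift E m (w - w2))%:rat = (P ^ N.to_nat w)%:R * m%:rat :> rat.
Proof.
move=> le_w2; rewrite /shift; case: N.eqb_spec => [w0|_].
  by have -> : w = w2 by lia.
case: N.eqb_spec => [->|_]; first by rewrite !mulr0.
rewrite rpow_E to_natM natrM mulrA -natrM to_natX -expnD to_natB subnKC //.
Qed.

Definition divides_out (j k d u : N) : Prop :=
  [/\ (N.to_nat d <= N.to_nat j)%N, coprime P (N.to_nat u)
    & N.to_nat k = (N.to_nat u * P ^ (N.to_nat j - N.to_nat d))%N].

(** The weight at the right end of the block is known exactly, for every [T]. *)
Lemma weight_end (j M d u : N) :
  (N.to_nat j <= T)%N -> divides_out j (M + 1) d u ->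
  let m := (T - N.to_nat j)%N in
  weight P T (N.to_nat M * P ^ m + (P ^ m).-1).+1 = (P ^ N.to_nat d)%:R * u%:rat^-1.
Proof.
move=> le_jT [le_dj cu kE] m.
have -> : (N.to_nat M * P ^ m + (P ^ m).-1).+1 = (N.to_nat u * P ^ (N.to_nat j - N.to_nat d) * P ^ m)%N.
  by rewrite -kE to_natD mulnDl mul1n -addnS prednK // expn_gt0 P_gt0.
rewrite /weight -{1}(subnK le_jT) -/m -{1}(subnK le_dj) !expnD !natrM.
have u0 : u%:rat != 0.
  rewrite pnatr_eq0; apply: contraTneq cu => ->; rewrite /coprime gcdn0.
  by case: P p_pr => [|[]].
have H1 := P_neq0 m; have H2 := P_neq0 (N.to_nat j - N.to_nat d).
move: (_%:R) H1 => x Hx; move: (_%:R) H2 => y Hy.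
by field; rewrite u0 Hx Hy.
Qed.

(** Up to the last interior point the bounds apply, and the right end adds one term: the
    value [B] of the shorter sum just before it, times the power of its weight.  The
    three summands of the last error are those of [z], of [B] and of the tabulated unit
    power. *)
Lemma advanceP K j d u M sg st bs :
  (N.to_nat j <= T)%N -> divides_out j (M + 1) d u ->
  let m := (T - N.to_nat j)%N in let n0 := (N.to_nat M * P ^ m)%N in
  state_ok n0 sg st -> bounds_ok n0 (P ^ m) (N.to_nat j) sg st bs ->
  let r := advance E K j d u (units E u) sg st bs in
  state_ok (n0 + P ^ m) sg r.1 /\ in_ball (scaled_sum sg (n0 + (P ^ m).-1)) r.2.
Proof.
move=> le_jT outk m n0; have wend := weight_end le_jT outk.
have [_ cu _] := outk.
have Em : (n0 + P ^ m = (n0 + (P ^ m).-1).+1)%N by rewrite -addnS prednK // expn_gt0 P_gt0.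
elim: sg st bs => [|s sg IHsg] st bs; first by case: st => [|b [|c st]] //= inb _; split.
case: st => [|x st]; first by case.
case: bs => [|b bs]; first by move=> _ [].
case=> inx okst' [Hany Herr Hctr okbd'].
have := IHsg _ _ okst' okbd'; rewrite [advance _ _ _ _ _ _ (s :: _) _ _]/=.
case: (advance _ _ _ _ _ _ sg _ _) => new y /= [oknew iny].
have [Hx1 low1] := state_ok_head okst'; set x1 := head ball0 st in Hx1 low1 Hctr *.
set js := ((j + 1) * s)%num; have jsE : N.to_nat js = ((N.to_nat j).+1 * N.to_nat s)%N.
  by rewrite /js; lia.
rewrite -jsE in Herr Hctr.
set w2 := N.min (low x) (bany b).
case: inx => Hx lowx; case: iny => Hy lowy.
have lt_q : ((P ^ m).-1 < P ^ m)%N by rewrite prednK // expn_gt0 P_gt0.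
set X0 := scaled_sum (s :: sg) n0 in Hx lowx Hany Herr.
set X2 := scaled_sum (s :: sg) (n0 + (P ^ m).-1) in Herr *.
have lowX2 : pdvd (N.to_nat w2) X2.
  rewrite -[X2](subrK X0); apply: pdvdD.
    by apply: pdvdW (Hany _ lt_q); rewrite /w2; lia.
  by apply: pdvdW lowx; rewrite /w2; lia.
set z := (if (bctr b =? 0)%num then _ else _).
have lowz : low z = w2 by rewrite /z; case: ifP.
have inz : in_ball X2 z.
  split; rewrite ?lowz //; rewrite /z; case: N.eqb_spec => [c0|c0] /=.
    rewrite shiftP; last by rewrite /w2; lia.
    rewrite c0 mulr0 subr0 in Herr; rewrite -[X2](subrK X0) -addrA.
    by apply: pdvdD; [apply: pdvdW Herr | apply: pdvdW Hx]; lia.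
  have lec : (N.to_nat w2 <= N.to_nat (low x1 + js))%N.
    by case: Hctr => // lec; rewrite /w2; lia.
  rewrite to_natD natrD mulrDr shiftP; last by rewrite /w2; lia.
  rewrite shiftP // to_natD expnD to_natM !natrM.
  set A := scaled_sum sg n0 in Herr Hx1; set Q := (P ^ N.to_nat js)%:R in Herr *.
  have -> : X2 - ((P ^ N.to_nat (low x))%:R * (mant x)%:rat
                  + (P ^ N.to_nat (low x1))%:R * Q * ((mant x1)%:rat * (bctr b)%:rat))
    = (X2 - X0 - A * Q * (bctr b)%:rat) + (X0 - (P ^ N.to_nat (low x))%:R * (mant x)%:rat)
      + (A - (P ^ N.to_nat (low x1))%:R * (mant x1)%:rat) * Q * (bctr b)%:rat by ring.
  apply: pdvdD; first by apply: pdvdD; [apply: pdvdW Herr | apply: pdvdW Hx]; lia.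
  apply: (@pdvdW _ _ (N.to_nat (prec x1) + N.to_nat js + 0)); first lia.
  by apply: pdvdM; [apply: pdvdM => //; apply: pdvd_nat | apply: pdvd_int].
have Hz := inz.1; rewrite lowz in Hz.
set wc := (low y + d * s)%num.
have Eterm : scaled_sum (s :: sg) (n0 + P ^ m)
    = X2 + scaled_sum sg (n0 + (P ^ m).-1) * ((P ^ N.to_nat (d * s)%num)%:R * u%:rat ^- N.to_nat s).
  rewrite {1}Em /scaled_sum [map _ _]/= hsumS -/(scaled_sum _ _); congr (_ + _ * _).
  by rewrite wend exprMn exprVn to_natM expnM [in RHS]natrX.
set B := scaled_sum sg (n0 + (P ^ m).-1) in Eterm Hy lowy.
set U := u%:rat ^- N.to_nat s in Eterm; set Q := (P ^ N.to_nat (d * s)%num)%:R in Eterm.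
have intU : pdvd 0 U by rewrite /U -exprVn; apply: pdvd_exp0 => //; apply: pdvd_inv.
have dvQ : pdvd (N.to_nat (d * s)) Q by apply: pdvd_nat.
have dvterm : pdvd (N.to_nat wc) (B * (Q * U)).
  apply: (@pdvdW _ _ (N.to_nat (low y) + (N.to_nat (d * s)%num + 0))); first by rewrite /wc; lia.
  by apply: pdvdM => //; apply: pdvdM.
set w3 := N.min w2 wc; set m2 := shift E (mant z) (w2 - w3).
have m2E : (P ^ N.to_nat w3)%:R * m2%:rat = (P ^ N.to_nat w2)%:R * (mant z)%:rat.
  by rewrite /m2 shiftP // /w3; lia.
set mk := (if (K <=? wc)%num then _ else _).
suff Hmk : pdvd (N.to_nat mk.2) (scaled_sum (s :: sg) (n0 + P ^ m) - (P ^ N.to_nat w3)%:R * (mk.1)%:rat).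
  rewrite (surjective_pairing mk) /=; split=> //; split=> //; split=> //=.
  rewrite Eterm; apply: pdvdD; first by apply: pdvdW lowX2; rewrite /w3; lia.
  by apply: pdvdW dvterm; rewrite /w3; lia.
have plain k : (N.to_nat k <= N.to_nat (prec z))%N -> pdvd (N.to_nat k) (B * (Q * U)) ->
    pdvd (N.to_nat k) (scaled_sum (s :: sg) (n0 + P ^ m) - (P ^ N.to_nat w3)%:R * m2%:rat).
  move=> lek Hk; rewrite m2E Eterm addrAC; apply: pdvdD => //.
  exact: pdvdW Hz.
rewrite /mk; case: ifP => [_|ltK] /=.
  by apply: plain; [lia | apply: pdvdW dvterm; lia].
case: N.eqb_spec => [y0|_].
  apply: plain => /=; first lia.
  rewrite y0 mulr0 subr0 in Hy.
  apply: (@pdvdW _ _ (N.to_nat (prec y) + (N.to_nat (d * s)%num + 0))); first lia.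
  by apply: pdvdM => //; apply: pdvdM.
case Eq: (unit_pow _ _ _ _ _) => [v|] /=; last by apply: plain; [lia | apply: pdvdW dvterm; lia].
rewrite to_natD natrD mulrDr m2E shiftP; last by rewrite /w3; lia.
rewrite Eterm /wc to_natD expnD !natrM -/Q to_natM natrM.
have HU := unit_powP p_pr units_E cu Eq; rewrite -/U in HU.
set L := (P ^ N.to_nat (low y))%:R in Hy *.
have -> : X2 + B * (Q * U) - ((P ^ N.to_nat w2)%:R * (mant z)%:rat + L * Q * ((mant y)%:rat * v%:rat))
  = (X2 - (P ^ N.to_nat w2)%:R * (mant z)%:rat) + (B - L * (mant y)%:rat) * (Q * U)
    + L * (mant y)%:rat * (Q * (U - v%:rat)) by ring.
apply: pdvdD; first apply: pdvdD.
- by apply: pdvdW Hz; lia.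
- apply: (@pdvdW _ _ (N.to_nat (prec y) + (N.to_nat (d * s)%num + 0))); first lia.
  by apply: pdvdM => //; apply: pdvdM.
apply: (@pdvdW _ _ (N.to_nat (low y) + 0 + (N.to_nat (d * s)%num + N.to_nat (K - wc)))).
  by rewrite /wc in ltK *; lia.
apply: pdvdM; last exact: pdvdM.
by apply: pdvdM; [apply: pdvd_nat | apply: pdvd_int].
Qed.

Lemma stripP fuel m w : (P ^ N.to_nat w)%:R * m%:rat =
  (P ^ N.to_nat (strip E fuel m w).2)%:R * (strip E fuel m w).1%:rat :> rat.
Proof.
elim: fuel m w => [|fuel IHf] m w //=.
have := N.div_eucl_spec m (radix E); case: N.div_eucl => q r /= mE.
case: N.eqb_spec => // r0; rewrite -IHf mE r0 N.add_0_r -/p.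
by rewrite to_natD to_natM addn1 expnS !natrM; ring.
Qed.

Lemma normalizeP x b : in_ball x b -> in_ball x (normalize E b).
Proof.
case=> Hb lowb; rewrite /normalize; case: N.leb_spec => [le|lt].
  split=> //=; rewrite mulr0 subr0; apply: pdvdW lowb; lia.
set m := (mant b mod _)%num.
have Hm : pdvd (N.to_nat (prec b)) (x - (P ^ N.to_nat (low b))%:R * m%:rat).
  apply: (pdvd_trans Hb); rewrite -mulrBr.
  apply: (@pdvdW _ _ (N.to_nat (low b) + N.to_nat (prec b - low b))); first lia.
  apply: pdvdM; first by apply: pdvd_nat.
  by rewrite /m rpow_E; apply: pdvd_modX.
case: N.eqb_spec => [m0|_].
  by rewrite m0 mulr0 subr0 in Hm; split=> //=; rewrite mulr0 subr0.
have := stripP (N.to_nat (prec b)) m (low b); case: strip => m' w /= Ew.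
case: N.leb_spec => [le|_]; last by split.
rewrite Ew in Hm; split=> //=; rewrite -[x](subrK ((P ^ N.to_nat w)%:R * m'%:rat)).
apply: pdvdD; first by apply: pdvdW Hm; lia.
by rewrite -[N.to_nat w]addn0; apply: pdvdM; [apply: pdvd_nat; rewrite addn0 | apply: pdvd_int].
Qed.

Lemma state_ok_normalize n sg st : state_ok n sg st -> state_ok n sg (map (normalize E) st).
Proof.
elim: sg st => [|s sg IHsg] [|b st] //=; first by case: st => //=; apply: normalizeP.
by case=> /normalizeP Hb /IHsg.
Qed.

Definition at_point (j M : N) (sg : seq N) (st : seq ball) : Prop :=
  state_ok (N.to_nat M * P ^ (T - N.to_nat j)) sg st.

Lemma at_point_refine j M sg st : (N.to_nat j < T)%N ->
  at_point j M sg st -> at_point (j + 1) (p * M) sg st.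
Proof.
move=> lt_jT; rewrite /at_point; have -> : N.to_nat (j + 1) = (N.to_nat j).+1 by lia.
rewrite to_natM -mulnA [(N.to_nat M * _)%N in X in _ -> X]mulnC mulnA -expnS -subSn //.
by rewrite subSS mulnC.
Qed.

Lemma at_point_coarsen j M sg st : (N.to_nat j < T)%N ->
  at_point (j + 1) (p * M) sg st -> at_point j M sg st.
Proof.
move=> lt_jT; rewrite /at_point; have -> : N.to_nat (j + 1) = (N.to_nat j).+1 by lia.
rewrite to_natM -mulnA [(N.to_nat M * _)%N in X in X -> _]mulnC mulnA -expnS -subSn //.
by rewrite subSS mulnC.
Qed.

Lemma crossP K j M d u sg st :
  (N.to_nat j <= N.to_nat D)%N -> divides_out j (M + 1) d u ->
  at_point j M sg st ->
  at_point j (M + 1) sg (cross E K j M d u sg st (bounds E K j M sg st)).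
Proof.
move=> le_jD outk okM; have le_jT : (N.to_nat j <= T)%N by apply: leq_trans le_DT.
have okb := boundsP K le_jD okM.
have [H _] := advanceP K le_jT outk okM okb.
by rewrite /at_point to_natD mulnDl mul1n.
Qed.

(** Refining replaces [M / p ^ j] by the same point [p M / p ^ (j + 1)], and the right
    ends of all sub-blocks but the last have a unit numerator. *)
Lemma walkP fuel K sg tail j M g u d st :
  (N.to_nat j + fuel <= N.to_nat D)%N -> divides_out j (M + 1) d u ->
  at_point j M sg st ->
  at_point j (M + 1) sg (walk E fuel K sg tail j M g u d st).
Proof.
elim: fuel j M g u d st => [|fuel IHf] j M g u d st /= le_D outk okM.
  by apply: crossP => //; lia.
case: ifP => _; last by apply: crossP => //; lia.
have lt_jT : (N.to_nat j < T)%N by lia.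
apply: state_ok_normalize; apply: at_point_coarsen => //.
have -> : (p * (M + 1))%num = (p * M + N.of_nat P)%num by lia.
apply: (@foldl_iotaN _ _ (fun i st => at_point (j + 1) (p * M + N.of_nat i) sg st)).
  by rewrite N.add_0_r; apply: at_point_refine.
move=> i y lt_i oky; rewrite -/p.
have -> : (p * M + N.of_nat i.+1)%num = (p * M + N.of_nat i + 1)%num by lia.
case: N.ltb_spec => [lt_i1|le_i1]; apply: IHf => //; try lia.
  split; rewrite ?subnn ?muln1 //.
  have -> : N.to_nat (p * M + N.of_nat i + 1) = (P * N.to_nat M + i.+1)%N by lia.
  rewrite /coprime mulnC gcdnMDl; move: (prime_coprime i.+1 p_pr); rewrite gtnNdvd //; lia.
have [le_dj cu kE] := outk; split=> //; first lia.
have -> : (p * M + N.of_nat i + 1)%num = (p * (M + 1))%num by lia.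
rewrite to_natM kE mulnCA -expnS; congr (_ * _ ^ _)%N; lia.
Qed.

Lemma unit_partP j k : (0 < N.to_nat k < P ^ (N.to_nat j).+1)%N ->
  divides_out j k (unit_part E (N.to_nat j) k j).2 (unit_part E (N.to_nat j) k j).1.
Proof.
have [n Dn] : exists n, N.to_nat j = n by exists (N.to_nat j).
rewrite Dn; elim: n j k Dn => [|n IHn] j k Dn /andP[k_gt0 lt_k] /=.
  split; rewrite ?subnn ?muln1 //.
  by rewrite prime_coprime // gtnNdvd // -[P]expn1.
have := N.div_eucl_spec k (radix E); have := N.mod_lt k (radix E).
rewrite /N.modulo; case: N.div_eucl => q r /= lt_r kE.
have {}lt_r : (r < radix E)%num by apply: lt_r; move: P_gt0; rewrite /p; lia.
case: N.eqb_spec => [r0|r0].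
  have kE' : N.to_nat k = (P * N.to_nat q)%N by rewrite kE r0 /p; lia.
  have [] := IHn (j - 1)%num q.
  - lia.
  - move: k_gt0 lt_k; rewrite kE' muln_gt0 expnS ltn_pmul2l // => /andP[_ ->] ->//.
  case: unit_part => u d /= le_d cu qE; split=> //; first lia.
  rewrite kE' qE mulnCA -expnS; congr (_ * _ ^ _)%N; lia.
split; rewrite ?subnn ?muln1 //= prime_coprime //.
have -> : N.to_nat k = (N.to_nat q * P + N.to_nat r)%N by rewrite kE /p; lia.
by rewrite dvdn_addr ?dvdn_mull // gtnNdvd //; rewrite /p; lia.
Qed.

Lemma goP K sg j M n d st : (N.to_nat j <= N.to_nat D)%N ->
  (N.to_nat (M + 1) < P ^ (N.to_nat j).+1)%N ->
  at_point j M sg st -> at_point j (M + 1) sg (go E K sg j M n d st).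
Proof.
move=> le_jD ltM okM; rewrite /go.
have := @unit_partP j (M + 1); rewrite ltM andbT => /(_ _).
case: unit_part => u e H; apply: walkP => //; first by rewrite -/D; lia.
by apply: H; lia.
Qed.

Lemma stepsP n K sg j M d st : (N.to_nat j <= N.to_nat D)%N ->
  (N.to_nat M + n < P ^ (N.to_nat j).+1)%N ->
  at_point j M sg st -> at_point j (M + N.of_nat n) sg (steps E n K sg j M d st).
Proof.
elim: n M st => [|n IHn] M st le_jD ltM okM /=; first by rewrite N.add_0_r.
have -> : (M + N.of_nat n.+1 = (M + 1) + N.of_nat n)%num by lia.
by apply: IHn => //; first lia; apply: goP => //; lia.
Qed.

Definition value (ds : seq N) : nat := foldl (fun v d => (v * P + N.to_nat d)%N) 0%N ds.

Lemma value_rcons ds d : value (rcons ds d) = (value ds * P + N.to_nat d)%N.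
Proof. by rewrite /value -cats1 foldl_cat. Qed.

Lemma descendP K sg ds last j M st :
  all (fun d => N.to_nat d < P)%N ds ->
  (N.to_nat j + size ds <= N.to_nat D)%N -> (N.to_nat M < P ^ N.to_nat j)%N ->
  at_point j (p * M) sg st ->
  let r := descend E K sg ds last j M st in
  [/\ N.to_nat r.1 = foldl (fun v d => (v * P + N.to_nat d)%N) (N.to_nat M) ds,
      (N.to_nat r.1 < P ^ (N.to_nat j + size ds))%N
    & at_point (j + N.of_nat (size ds)) (p * r.1) sg r.2].
Proof.
elim: ds j M st => [|d ds IHds] j M st /=.
  by move=> _ _ ltM okM; rewrite addn0 N.add_0_r.
case/andP=> ltd ltds le_D ltM okM.
have ltM' : (N.to_nat (p * M + d) < P ^ (N.to_nat j).+1)%N.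
  have -> : N.to_nat (p * M + d) = (P * N.to_nat M + N.to_nat d)%N by lia.
  rewrite expnS; apply: (@leq_trans (P * (N.to_nat M).+1)); first by rewrite mulnS; lia.
  by rewrite leq_mul2l ltM orbT.
have j1 : N.to_nat (j + 1) = (N.to_nat j).+1 by lia.
set st' := steps _ _ _ _ _ _ _ _.
have okst' : at_point j (p * M + d) sg st'.
  rewrite -[d]N2Nat.id; apply: stepsP => //; first lia.
  by move: ltM'; rewrite to_natD.
have le_D' : (N.to_nat (j + 1) + size ds <= N.to_nat D)%N by rewrite j1 addSnnS.
have okst1 : at_point (j + 1) (p * (p * M + d)) sg st' by apply: at_point_refine => //; lia.
have [|E1 E2 E3] := IHds (j + 1)%num _ st' ltds le_D' _ okst1; first by rewrite j1.
split; last by have -> : (j + N.of_nat (size ds).+1 = j + 1 + N.of_nat (size ds))%num by lia.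
- by rewrite E1 to_natD to_natM mulnC.
- by rewrite -addSnnS -j1.
Qed.

Definition divisible sg n : Prop :=
  pdvd 1 (hsum (fun k => k%:R^-1) [seq N.to_nat s | s <- sg] n).

Lemma divisible_scaled_sum sg n : divisible sg n ->
  pdvd (T * sumn [seq N.to_nat s | s <- sg] + 1) (scaled_sum sg n).
Proof.
move=> H; have -> : scaled_sum sg n = (P ^ (T * sumn [seq N.to_nat s | s <- sg]))%:R
    * hsum (fun k => k%:R^-1) [seq N.to_nat s | s <- sg] n.
  by rewrite /scaled_sum hsum_scale -natrX -expnM.
by apply: pdvdM => //; apply: pdvd_nat.
Qed.

Definition box_dead (j : N) (v : nat) (sg : seq N) : Prop :=
  forall n, (n %/ P ^ (T - N.to_nat j) = v)%N -> (size sg <= n)%N -> ~ divisible sg n.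

Let sumE (sg : seq N) : N.to_nat (foldr N.add 0%num sg) = sumn [seq N.to_nat s | s <- sg].
Proof. by elim: sg => //= s sg <-; rewrite to_natD. Qed.

(** For [n] in the block, the value at the left end is the rescaled sum at [n] minus a
    change divisible by [p ^ c]; if [n] were in the divisible set, this would make the
    mantissa vanish modulo [p ^ (e - low)].  At the bottom, a block is one integer, and
    those below the length of [sg] are excluded by definition. *)
Lemma statusP K j M sg st : (N.to_nat j <= N.to_nat D)%N -> at_point j M sg st ->
  status E K j M sg st = Dead -> box_dead j (N.to_nat M) sg.
Proof.
move=> le_jD okM; rewrite /status; set x := head ball0 st; set c := bany _.
set e := N.min (N.min (prec x) c) _; set m := (T - N.to_nat j)%N.
have nE n : (n %/ P ^ m = N.to_nat M)%N ->
    exists2 i, (i < P ^ m)%N & n = (N.to_nat M * P ^ m + i)%N.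
  by move=> <-; exists (n %% P ^ m)%N; rewrite ?ltn_mod ?expn_gt0 ?P_gt0 // -divn_eq.
case: ifP => [/andP[/N.ltb_lt lt_e nz] _|_].
  move=> n /nE[i lt_i ->] _ /divisible_scaled_sum Hn.
  have [Hx _] := state_ok_head okM; rewrite -/x in Hx.
  have Hc := bounds_ok_any (boundsP 0 le_jD okM) lt_i; rewrite -/c in Hc.
  have : pdvd (N.to_nat e) ((P ^ N.to_nat (low x))%:R * (mant x)%:rat).
    set y := _ * _ in Hx *.
    have -> : y = scaled_sum sg (N.to_nat M * P ^ m + i)
      - (scaled_sum sg (N.to_nat M * P ^ m + i) - scaled_sum sg (N.to_nat M * P ^ m))
      - (scaled_sum sg (N.to_nat M * P ^ m) - y) by ring.
    apply: pdvdB; first apply: pdvdB.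
    - apply: pdvdW Hn; rewrite /e !to_nat_min to_natD to_natM sumE.
      by rewrite geq_min leq_add2r leq_mul2r le_DT !orbT.
    - by apply: pdvdW Hc; rewrite /e; lia.
    - by apply: pdvdW Hx; rewrite /e; lia.
  rewrite -natrM pdvd_natE //; have -> : N.to_nat e = (N.to_nat (low x) + N.to_nat (e - low x))%N by lia.
  rewrite expnD dvdn_pmul2l ?expn_gt0 ?P_gt0 // => dv.
  case/negP: nz; apply/N.eqb_eq; apply: N2Nat.inj.
  rewrite rpow_E to_nat_mod ?to_natX ?expn_gt0 ?P_gt0 //.
  exact/eqP.
case: ifP => [/andP[exE /N.eqb_eq jD]|_]; last by case: ifP => _ //; case: ifP.
case: N.ltb_spec => // ltM _ n; rewrite exact_T // -/m jD subnn expn0 divn1 => ->; lia.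
Qed.

Lemma childrenP n K sg j M st i :
  (N.to_nat j <= N.to_nat D)%N -> (N.to_nat M + n < P ^ (N.to_nat j).+1)%N ->
  at_point j M sg st -> nth Unknown (children E n K sg j M st) i = Dead ->
  box_dead j (N.to_nat M + i) sg.
Proof.
elim: n M st i => [|n IHn] M st [|i] le_jD ltM okM /=; rewrite ?addn0 ?nth_nil //;
  try exact: statusP.
have -> : (N.to_nat M + i.+1 = N.to_nat (M + 1) + i)%N by lia.
by apply: IHn => //; [lia | apply: goP => //; lia].
Qed.

Let state_ok0 K sg : at_point 0 (p * 0) sg (rcons [seq Ball 0 K K | _ <- sg] (Ball 1 K 0)).
Proof.
rewrite /at_point N.mul_0_r mul0n; elim: sg => [|s sg IHsg] /=.
  by split; rewrite /= ?mul1r ?subrr; [exact: pdvd0 | exact: (pdvd_int _ 1)].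
by split=> //; rewrite /scaled_sum [map _ _]/= hsum0; split; rewrite ?mulr0 ?subrr; exact: pdvd0.
Qed.

Lemma settleP fuel K sg ds pend alive al :
  all (fun d => N.to_nat d < P)%N ds -> (size ds <= N.to_nat D)%N ->
  all (fun d => N.to_nat d < P)%N pend ->
  settle E fuel K sg ds pend alive = Some al ->
  {subset alive <= al} /\
  {in pend, forall r, r \in al \/ box_dead (N.of_nat (size ds)) (value ds * P + N.to_nat r) sg}.
Proof.
move=> ltds le_D; elim: fuel K pend alive => [|fuel IHf] K pend alive /= ltpend.
  by case: pend {ltpend} => // -[<-]; split.
set last := foldl _ _ _; have last_lt : (N.to_nat last < P)%N.
  rewrite /last; have : (N.to_nat 0 < P)%N by [].
  elim: (pend) (0%num) ltpend => //= r l IHl x /andP[ltr ltl] ltx.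
  by apply: IHl => //; lia.
case Dp: {1}pend => [|r0 l]; first by case=> <-; split=> // r; rewrite Dp in_nil.
move=> {r0 l Dp}.
have [] := @descendP K sg ds last 0 0 _ ltds le_D isT (state_ok0 K sg).
case: descend => M st /=; rewrite add0n -/(value ds) => ME ltM okM.
set vs := children _ _ _ _ _ _ _; pose v r := nth Unknown vs (N.to_nat r).
have Dead_v r : v r = Dead -> box_dead (N.of_nat (size ds)) (value ds * P + N.to_nat r) sg.
  have -> : (value ds * P + N.to_nat r = N.to_nat (p * M) + N.to_nat r)%N by rewrite -ME; lia.
  apply: childrenP => //; rewrite Nat2N.id // expnS to_natM.
  by apply: (@leq_trans (P * (N.to_nat M).+1)); [rewrite mulnS; lia | rewrite leq_mul2l ltM orbT].
case: ifP => // noStuck /IHf[|sub Hal].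
  by apply/allP => r; rewrite mem_filter => /andP[_ /(allP ltpend)].
split=> [r|r rp]; first by move=> ra; apply: sub; rewrite mem_cat ra orbT.
case Ev: (v r).
- by right; apply: Dead_v.
- by left; apply: sub; rewrite mem_cat mem_filter -/v -/(v r) Ev rp.
- by apply: Hal; rewrite mem_filter -/(v r) Ev.
- by case/hasP: noStuck; exists r; rewrite // -/(v r) Ev.
Qed.

Let expandS fuel sg ds : expand E fuel.+1 sg ds =
  if settle E 9 (initial_precision E sg ds) sg ds
       (if ds is [::] then behead (iotaN p) else iotaN p) [::] is Some al then
    all (fun r => expand E fuel sg (rcons ds r)) al
  else false.
Proof. by []. Qed.

(** The digit of [n] that follows [ds] is either excluded by [settle] or among the
    digits explored further. *)
Lemma expandP fuel sg ds : (size ds + fuel <= (N.to_nat D).+1)%N ->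
  all (fun d => N.to_nat d < P)%N ds -> expand E fuel sg ds ->
  forall n, (n %/ P ^ (T.+1 - size ds) = value ds)%N -> (ds = [::] -> (P ^ T <= n)%N) ->
  (size sg <= n)%N -> ~ divisible sg n.
Proof.
elim: fuel ds => [|fuel IHf] ds // le_D ltds; rewrite expandS.
set pend := (if ds is [::] then _ else _).
have le_dsD : (size ds <= N.to_nat D)%N by lia.
have le_dsT : (size ds <= T)%N by apply: leq_trans le_DT.
case Es: (settle _ _ _ _ _ _ _) => [al|] // /allP Hal n nE n_ge le_n.
have ltpend : all (fun d => N.to_nat d < P)%N pend.
  rewrite /pend; apply/allP => r; case: (ds) => [|? ?]; last by rewrite mem_iotaN.
  by move/mem_behead; rewrite mem_iotaN.
have [_ Hp] := settleP ltds le_dsD ltpend Es.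
pose r := N.of_nat (n %/ P ^ (T - size ds) %% P).
have rE : N.to_nat r = (n %/ P ^ (T - size ds) %% P)%N by rewrite Nat2N.id.
have nE' : (n %/ P ^ (T - size ds) = value ds * P + N.to_nat r)%N.
  by rewrite rE -nE subSn // expnSr divnMA -divn_eq.
have lt_r : (N.to_nat r < P)%N by rewrite rE ltn_mod.
have r_pend : r \in pend.
  rewrite /pend; case Eds: (ds) => [|? ?]; last by rewrite mem_iotaN.
  rewrite behead_iotaN; apply/mapP; exists (N.to_nat r); last by rewrite N2Nat.id.
  have r_gt0 : (0 < N.to_nat r)%N.
    have -> : N.to_nat r = (n %/ P ^ T)%N by rewrite -[T in RHS]subn0 -[0%N in RHS]/(size (@nil N)) -Eds nE' Eds.
    by rewrite divn_gt0 ?expn_gt0 ?P_gt0 // n_ge.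
  by rewrite mem_iota r_gt0 add1n prednK.
case: (Hp r r_pend) => [r_al|dead]; last first.
  by apply: dead => //; rewrite Nat2N.id.
apply: (IHf (rcons ds r)) => //.
- by rewrite size_rcons; lia.
- by rewrite all_rcons lt_r.
- exact: Hal.
- by rewrite size_rcons subSS value_rcons.
- by case: (ds).
Qed.

Theorem certifyP sg n : certify E sg -> (P ^ T <= n < P ^ T.+1)%N -> (size sg <= n)%N ->
  ~ divisible sg n.
Proof.
move=> cert /andP[le_n lt_n]; apply: (expandP _ _ cert) => //.
by rewrite subn0 divn_small.
Qed.

End SearchCorrect.

(** * Equal exponents at the prime 2 *)

Section EqualExponents.
Variable s : nat.
Local Notation pdvd := (pdvd 2).

(** The coefficients of the recurrence [threshold_sumSS]. *)
Definition lead (t k : nat) : rat := if (2 ^ t %| k)%N then ((k %/ 2 ^ t) ^ s)%:R else 1.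
Definition tail (t k : nat) : rat := lead t k * weight 2 t k ^+ s.
Definition threshold_sum (t n l : nat) : rat :=
  ((n %/ 2 ^ t)`! ^ s)%:R * hsum (weight 2 t) (nseq l s) n.

Let dfact t n : ((n.+1 %/ 2 ^ t)`! ^ s)%:R = ((n %/ 2 ^ t)`! ^ s)%:R * lead t n.+1 :> rat.
Proof.
rewrite /lead divnS ?expn_gt0 //; case: (_ %| _)%N; last by rewrite mulr1.
by rewrite add1n factS expnMn mulnC natrM.
Qed.

Lemma threshold_sumS0 t n : threshold_sum t n.+1 0 = threshold_sum t n 0 * lead t n.+1.
Proof. by rewrite /threshold_sum dfact /= !mulr1. Qed.

Lemma threshold_sumSS t n l :
  threshold_sum t n.+1 l.+1 = threshold_sum t n l.+1 * lead t n.+1 + threshold_sum t n l * tail t n.+1.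
Proof. by rewrite /threshold_sum dfact [nseq _ _]/= hsumS /tail; ring. Qed.

Let two_neq0 t : (2 ^ t)%:R != 0 :> rat.
Proof. by rewrite pnatr_eq0 expn_eq0. Qed.

Lemma lead_int t k : pdvd 0 (lead t k).
Proof. by rewrite /lead; case: ifP => _; [exact: pdvd_int | exact: (pdvd_int _ 1)]. Qed.

(** At the multiples of [2 ^ t] the factor [(k / 2 ^ t) ^ s] cancels the weight. *)
Lemma tail_dvd t k : (2 ^ t %| k)%N -> (0 < k)%N -> tail t k = 1.
Proof.
move=> dv k_gt0; rewrite /tail /lead dv natrX -exprMn.
have x_neq0 : (k %/ 2 ^ t)%:R != 0 :> rat by rewrite pnatr_eq0 -lt0n divn_gt0 ?expn_gt0 // dvdn_leq.
have -> : weight 2 t k = (k %/ 2 ^ t)%:R^-1.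
  by rewrite /weight -{1}(divnK dv) natrM invfM mulrCA mulfV ?two_neq0 // mulr1.
by rewrite mulfV // expr1n.
Qed.

Lemma tail_ndvd h i k : (0 < k)%N -> ~~ (2 ^ i %| k)%N -> pdvd (s * h.+1) (tail (h + i) k).
Proof.
move=> k_gt0 nd; rewrite /tail -[(s * _)%N]add0n; apply: pdvdM; first exact: lead_int.
rewrite mulnC; apply: pdvd_exp.
have := @pdvd_weight 2 isT (h + i) i k k_gt0; rewrite addnK leq_addl; exact.
Qed.

Lemma tail_int t k : (0 < k)%N -> pdvd 0 (tail t k).
Proof.
move=> k_gt0; case: (boolP (2 ^ t %| k)%N) => [dv|nd].
  by rewrite tail_dvd //; apply: (pdvd_int _ 1).
by apply: (@pdvdW _ _ (s * 1)) => //; apply: (@tail_ndvd 0).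
Qed.

Lemma threshold_sum_int t n l : pdvd 0 (threshold_sum t n l).
Proof.
elim: n l => [|n IHn] l.
  rewrite /threshold_sum div0n fact0 exp1n mul1r; case: l => [|l]; first exact: (pdvd_int _ 1).
  by rewrite [nseq _ _]/= hsum0; apply: pdvd0.
case: l => [|l]; first by rewrite threshold_sumS0 -[0%N]addn0; apply: pdvdM; [|exact: lead_int].
rewrite threshold_sumSS; apply: pdvdD; rewrite -[0%N]addn0; apply: pdvdM => //.
  exact: lead_int.
exact: tail_int.
Qed.

(** At the multiples [2 ^ i * k] of [2 ^ i], the recurrence for the threshold [h + i] is
    the recurrence at [k] for the threshold [h].  Elsewhere its first coefficient is 1
    and its second one vanishes modulo [2 ^ (s h.+1)]. *)
Lemma threshold_sum_congr h i n l :
  pdvd (s * h.+1) (threshold_sum (h + i) n l - threshold_sum h (n %/ 2 ^ i) l).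
Proof.
set e := (s * _)%N.
have mulE x y z : pdvd e (x - y) -> pdvd 0 z -> pdvd e (x * z - y * z).
  by move=> H Hz; rewrite -mulrBl -[e]addn0; apply: pdvdM.
elim: n l => [|n IHn] l.
  rewrite /threshold_sum !div0n; case: l => [|l]; first by rewrite subrr; apply: pdvd0.
  by rewrite [nseq _ _]/= !hsum0 !mulr0 subrr; apply: pdvd0.
rewrite divnS ?expn_gt0 //; case: (boolP (2 ^ i %| n.+1)%N) => [dv|nd] /=.
  rewrite add1n; have nE : (n %/ 2 ^ i).+1 = (n.+1 %/ 2 ^ i)%N by rewrite divnS ?expn_gt0 // dv.
  have leadE : lead (h + i) n.+1 = lead h (n %/ 2 ^ i).+1.
    by rewrite /lead nE expnD dvdn_divRL // mulnC divnMA mulnC.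
  have tailE : tail (h + i) n.+1 = tail h (n %/ 2 ^ i).+1.
    rewrite /tail leadE; congr (_ * _ ^+ _); rewrite /weight nE -{1}(divnK dv) expnD !natrM.
    by rewrite invfM [RHS]mulrC mulrACA divff ?two_neq0 // mulr1 mulrC.
  case: l => [|l]; first by rewrite !threshold_sumS0 leadE; apply: mulE; [|exact: lead_int].
  rewrite !threshold_sumSS leadE tailE opprD addrACA; apply: pdvdD; apply: mulE => //.
    exact: lead_int.
  exact: tail_int.
rewrite add0n; have lead1 : lead (h + i) n.+1 = 1.
  by rewrite /lead expnD; case: ifP => // dv; case/negP: nd; apply: dvdn_trans dv; apply: dvdn_mull.
case: l => [|l]; first by rewrite threshold_sumS0 lead1 mulr1.
rewrite threshold_sumSS lead1 mulr1 addrAC; apply: pdvdD => //.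
rewrite -[e]add0n; apply: pdvdM; [exact: threshold_sum_int | exact: tail_ndvd].
Qed.

Lemma threshold_sum_divisible t n l v :
  (2 ^ v %| (n %/ 2 ^ t)`!)%N -> pdvd 1 (hsum (fun k => k%:R^-1) (nseq l s) n) ->
  pdvd (s * v + (t * s * l + 1)) (threshold_sum t n l).
Proof.
move=> dv H; rewrite /threshold_sum; apply: pdvdM.
  by rewrite natrX mulnC; apply: pdvd_exp; apply: pdvd_nat.
rewrite /weight hsum_scale; apply: pdvdM => //.
rewrite -natrX -expnM; apply: pdvd_nat.
by rewrite sumn_nseq mulnA.
Qed.

End EqualExponents.

Section EqualExponentsSearch.

(** Cancels [k / 2 ^ t] to [u / 2 ^ r]. *)
Fixpoint halve (t : nat) (k : N) : N * nat :=
  if t is t'.+1 then if N.even k then halve t' (N.div2 k) else (k, t) else (k, 0%N).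

Definition power (e : N) (x s : N) : N := if s is Npos s' then powmod x (2 ^ e)%num s' else 1%num.

Definition factors (s e : N) (t : nat) (k : N) : option (N * N) :=
  let: (u, r) := halve t k in
  if r is 0%N then Some (power e u s, 1%num)
  else if invmod 2 u e is Some q then Some (1%num, power e (2 ^ N.of_nat r * q)%num s) else None.

(** The entries of a row are indexed by [l], and [prev] is the entry before the first one
    of [cs]; the recurrence is evaluated modulo a power of 2 by masking bits. *)
Fixpoint add_row (mask a b prev : N) (cs : seq N) : seq N :=
  if cs is c :: cs' then N.land (a * c + b * prev) mask :: add_row mask a b c cs' else [::].

Fixpoint rows (fac : N -> option (N * N)) (mask : N) (n : nat) (k : N)
    (cs : seq N) : option (seq (seq N)) :=
  if n is n'.+1 then
    if fac k is Some (a, b) then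
      if rows fac mask n' (k + 1)%num (add_row mask a b 0 cs) is Some rs then Some (cs :: rs) else None
    else None
  else Some [:: cs].

Definition table_of_sums (fac : N -> option (N * N)) (e : N) (L n : nat) : option (nat -> nat -> N) :=
  if rows fac (N.ones e) n 1 (1%num :: nseq L 0%num) is Some rs then
    Some (fun m l => nth 0%num (nth [::] rs m) l) else None.

Local Notation pdvd := (pdvd 2).

Definition factors_ok (s : nat) (e : N) (t : nat) (fac : N -> option (N * N)) : Prop :=
  forall k a b, fac (N.of_nat k.+1) = Some (a, b) ->
  pdvd (N.to_nat e) (lead s t k.+1 - a%:rat) /\ pdvd (N.to_nat e) (tail s t k.+1 - b%:rat).

Lemma halveP t k u r : halve t k = (u, r) ->
  [/\ (r <= t)%N, N.to_nat k = (N.to_nat u * 2 ^ (t - r))%N & r = 0%N \/ odd (N.to_nat u)].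
Proof.
elim: t k => [|t IHt] k /=; first by case=> <- <-; rewrite muln1; split=> //; left.
case Ek: (N.even k) => [|]; last first.
  case=> <- <-; rewrite subnn muln1; split=> //; right.
  have := N.negb_even k; rewrite Ek => /esym; rewrite N.odd_spec => -[x ->]; lia.
move/IHt => [le_rt kE ou]; split=> //; first exact: leqW.
rewrite subSn // expnSr mulnA -kE.
by move/N.even_spec: Ek => [x ->]; rewrite N.div2_double; lia.
Qed.

Lemma powerP e x s y : pdvd 0 y -> pdvd (N.to_nat e) (y - x%:rat) ->
  pdvd (N.to_nat e) (y ^+ N.to_nat s - (power e x s)%:rat).
Proof.
move=> Hy Hxy; case: s => [|s] /=; first by rewrite subrr; apply: pdvd0.
apply: (pdvd_trans _ (@powmodP 2 isT e x s)).
by apply: pdvd_subX => //; apply: pdvd_int.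
Qed.

Lemma factorsP s e t : factors_ok (N.to_nat s) e t (factors s e t).
Proof.
move=> k a b; rewrite /factors; case Eh: halve => [u r].
have [le_rt] := halveP Eh; rewrite Nat2N.id => kE ou.
have two_neq0 x : (2 ^ x)%:R != 0 :> rat by rewrite pnatr_eq0 expn_eq0.
case: r => [|r] in le_rt kE ou Eh *.
  case=> <- <-; rewrite subn0 in kE.
  have dv : (2 ^ t %| k.+1)%N by rewrite kE dvdn_mull.
  rewrite tail_dvd // subrr /lead dv kE mulnK ?expn_gt0 // natrX; split; last exact: pdvd0.
  by apply: powerP; [exact: pdvd_int | rewrite subrr; exact: pdvd0].
have {}ou : coprime 2 (N.to_nat u) by case: ou => //; rewrite coprime2n.
have nd : ~~ (2 ^ t %| k.+1)%N.
  rewrite kE -{1}(subnK le_rt) expnD mulnC dvdn_pmul2r ?expn_gt0 //.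
  apply/negP => /(dvdn_trans (dvdn_exp (isT : (0 < r.+1)%N) (dvdnn 2))).
  by rewrite dvdn2; move: ou; rewrite coprime2n => ->.
case Ei: (invmod _ _ _) => [q|] // [<- <-].
rewrite /tail /lead (negbTE nd) subrr mul1r; split; first exact: pdvd0.
have u_neq0 : u%:rat != 0 by apply: contraTneq ou => /eqP; rewrite pnatr_eq0 => /eqP ->.
have -> : weight 2 t k.+1 = (2 ^ r.+1)%:R * u%:rat^-1.
  rewrite /weight kE -{1}(subnK le_rt) expnD !natrM.
  move: (_%:R) (_%:R) (_%:R) (two_neq0 (t - r.+1)%N) u_neq0 => x y z Hx Hz; field; by rewrite Hx Hz.
apply: powerP.
  by rewrite -[0%N]addn0; apply: pdvdM; [exact: pdvd_int | exact: pdvd_inv].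
rewrite -[X in _ - X]/((2 ^ N.of_nat r.+1 * q)%num%:rat) to_natM to_natX Nat2N.id natrM -mulrBr -[N.to_nat e]add0n.
by apply: pdvdM; [exact: pdvd_int | exact: invmodP Ei].
Qed.

Definition row_ok (s : nat) (e : N) (t n : nat) (cs : seq N) : Prop :=
  forall i, (i < size cs)%N -> pdvd (N.to_nat e) (threshold_sum s t n i - (nth 0%num cs i)%:rat).

Lemma size_add_row mask a b c cs : size (add_row mask a b c cs) = size cs.
Proof. by elim: cs c => //= x cs IHcs c; rewrite IHcs. Qed.

Lemma nth_add_row mask a b c cs i : (i < size cs)%N ->
  nth 0%num (add_row mask a b c cs) i
  = N.land (a * nth 0%num cs i + b * nth 0%num (c :: cs) i) mask.
Proof. by elim: cs c i => [|x cs IHcs] c [|i] //= /IHcs ->. Qed.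

Lemma add_rowP s e t fac n cs a b : factors_ok s e t fac -> row_ok s e t n cs ->
  fac (N.of_nat n.+1) = Some (a, b) -> row_ok s e t n.+1 (add_row (N.ones e) a b 0 cs).
Proof.
move=> fac_ok ok_cs /fac_ok[Ha Hb] i; rewrite size_add_row => lt_i; rewrite nth_add_row //.
have mulE x y z w : pdvd 0 x -> pdvd (N.to_nat e) (x - y%:rat) -> pdvd (N.to_nat e) (z - w%:rat) ->
    pdvd (N.to_nat e) (x * z - (y * w)%num%:rat).
  by move=> Hx Hxy Hzw; rewrite to_natM natrM; apply: pdvd_sub_mul => //; apply: pdvd_int.
rewrite N.land_ones; apply: (@pdvd_modX' 2).
rewrite [(a * _)%num]N.mul_comm [(b * _)%num]N.mul_comm to_natD natrD.
case: i lt_i => [|i] lt_i.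
  rewrite /= addr0 threshold_sumS0; apply: mulE => //; [exact: threshold_sum_int | exact: ok_cs].
rewrite threshold_sumSS opprD addrACA; apply: pdvdD; apply: mulE => //; try exact: threshold_sum_int.
  exact: ok_cs.
by apply: ok_cs; apply: ltnW.
Qed.

Lemma rowsP s e t fac k n0 n cs rs : factors_ok s e t fac -> row_ok s e t n0 cs ->
  k = N.of_nat n0.+1 -> rows fac (N.ones e) n k cs = Some rs -> forall m, (m <= n)%N ->
  row_ok s e t (n0 + m) (nth [::] rs m) /\ size (nth [::] rs m) = size cs.
Proof.
move=> fac_ok; elim: n n0 k cs rs => [|n IHn] n0 k cs rs ok_cs kE /=.
  by case=> <- [|m] //; rewrite addn0.
case Ef: fac => [[a b]|] //; rewrite kE in Ef; case Er: rows => [rs'|] // [<-] [|m] le_m.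
  by rewrite addn0.
have [|ok' sz] := IHn n0.+1 _ _ _ (add_rowP fac_ok ok_cs Ef) _ Er m le_m; first lia.
by rewrite addnS -addSn; split=> //=; rewrite sz size_add_row.
Qed.

Lemma row_ok0 s e t l : row_ok s e t 0 (1%num :: nseq l 0%num).
Proof.
move=> [_|i]; rewrite /threshold_sum div0n fact0 exp1n mul1r /=; first by rewrite subrr; apply: pdvd0.
by rewrite ltnS size_nseq => lt_i; rewrite nth_nseq lt_i big_ord0 subrr; apply: pdvd0.
Qed.

Lemma table_of_sumsP s e t fac L n c l m : factors_ok s e t fac ->
  table_of_sums fac e L n = Some c -> (m <= n)%N -> (l <= L)%N ->
  pdvd (N.to_nat e) (threshold_sum s t m l - (c m l)%:rat).
Proof.
move=> fac_ok; rewrite /table_of_sums; case Er: rows => [rs|] // [<-] le_m le_l.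
have [ok_cs sz] := rowsP fac_ok (@row_ok0 s e t L) erefl Er le_m.
by apply: ok_cs; rewrite sz /= size_nseq.
Qed.

(** The exponent of 2 in [m`!]. *)
Definition fact_twos (m : nat) : nat := sumn [seq logn 2 k | k <- iota 1 m].

Lemma fact_twosP m : (2 ^ fact_twos m %| m`!)%N.
Proof.
rewrite /fact_twos; elim: m => // m IHm.
rewrite -[m.+1]addn1 iotaD map_cat sumn_cat /= addn0 add1n addn1.
by rewrite factS expnD mulnC dvdn_mul // pfactor_dvdnn.
Qed.

(** The exponent of 2 by which [threshold_sum h M l] must be divisible if 2 divides the
    numerator of the harmonic sum at [M] itself. *)
Definition loss (s l h M : nat) : nat := (s * fact_twos (M %/ 2 ^ h) + (h * s * l + 1))%N.

(** Ten bits beyond the modulus of [threshold_sum_congr], to treat [n = M] in the cases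
    where the residue vanishes modulo [2 ^ (s h.+1)]. *)
Definition precision (s h : nat) : nat := (s * h.+1 + 10)%N.

Definition nonzero_mod (c : N) (e : nat) : bool := ~~ (c mod 2 ^ N.of_nat e =? 0)%num.

(** A pair [(l, M)] in [pend] stands for the integers [n = M] and, more generally, all
    [n] with binary expansion starting with that of [M].  The integer [M] itself is
    treated directly; the others through the residue, or else at the next level. *)
Fixpoint sweep (fuel s h L : nat) (pend : seq (nat * nat)) : bool :=
  if pend is [::] then true else
  if fuel is f.+1 then
    let e := precision s h in
    if table_of_sums (factors (N.of_nat s) (N.of_nat e) h) (N.of_nat e) L
         (foldr maxn 0%N (unzip2 pend)) is Some c then
      all (fun x => nonzero_mod (c x.2 x.1) (minn (loss s x.1 h x.2) e)) pend &&
      sweep f s h.+1 L (flatten [seq [:: (x.1, x.2.*2); (x.1, x.2.*2.+1)] |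
        x <- pend & ~~ nonzero_mod (c x.2 x.1) (s * h.+1)])
    else false
  else false.

Definition harmonic (s l n : nat) : rat := hsum (fun k => k%:R^-1) (nseq l s) n.

Lemma ndvd_threshold_sum s l t n c e f : (f <= e)%N -> pdvd e (threshold_sum s t n l - c%:rat) ->
  nonzero_mod c f -> ~ pdvd f (threshold_sum s t n l).
Proof.
move=> le_fe H; apply: contraNnot => K; apply/N.eqb_eq; apply: N2Nat.inj.
have -> : N.to_nat (c mod 2 ^ N.of_nat f) = (N.to_nat c %% 2 ^ f)%N.
  by rewrite to_nat_mod to_natX Nat2N.id // expn_gt0.
apply/eqP; rewrite -[_ == _]/(2 ^ f %| N.to_nat c)%N; apply/pdvd_natE.
have -> : c%:rat = threshold_sum s t n l - (threshold_sum s t n l - c%:rat) by ring.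
by apply: pdvdB => //; apply: pdvdW H.
Qed.

(** For [i.+1] more digits the threshold is [h + i.+1], and then divisibility of the
    harmonic sum forces at least [s h.+1] factors 2 into the threshold sum. *)
Lemma box_ndvd s l h M c e f : (0 < l)%N -> (f <= e)%N -> (f <= s * h.+1)%N ->
  pdvd e (threshold_sum s h M l - c%:rat) -> nonzero_mod c f ->
  forall i n, (n %/ 2 ^ i.+1 = M)%N -> ~ pdvd 1 (harmonic s l n).
Proof.
move=> l_gt0 le_fe le_f Hc nz i n nE Hn; apply: (ndvd_threshold_sum le_fe Hc nz).
apply: (pdvdW le_f).
have -> : threshold_sum s h M l = threshold_sum s (h + i.+1) n l
    - (threshold_sum s (h + i.+1) n l - threshold_sum s h M l) by ring.
apply: pdvdB; last by rewrite -nE; apply: threshold_sum_congr.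
apply: pdvdW (@threshold_sum_divisible _ _ _ _ 0 (dvd1n _) Hn).
rewrite muln0 add0n; apply: (@leq_trans ((h + i.+1) * s * 1)); first by rewrite muln1 mulnC leq_mul2r; lia.
by apply: leq_trans (leq_addr 1 _); rewrite leq_mul2l l_gt0 orbT.
Qed.

Lemma sweepP fuel s h L pend : sweep fuel s h L pend ->
  forall l M, (l, M) \in pend -> (0 < l <= L)%N ->
  forall i n, (n %/ 2 ^ i = M)%N -> ~ pdvd 1 (harmonic s l n).
Proof.
elim: fuel h pend => [|fuel IHf] h pend /=; first by case: pend.
case Dp: {1}pend => [|x q]; first by rewrite Dp.
move=> {x q Dp}; set e := precision s h.
case Ec: table_of_sums => [c|] // /andP[/allP exact_ok /IHf{}IHf] l M lM_pend /andP[l_gt0 le_lL] i n nE.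
have le_M : (M <= foldr maxn 0 (unzip2 pend))%N.
  elim: (pend) lM_pend => //= x q IHq; rewrite in_cons leq_max.
  by case/orP => [/eqP <- | /IHq ->]; rewrite ?leqnn ?orbT.
have := table_of_sumsP (@factorsP (N.of_nat s) (N.of_nat e) h) Ec le_M le_lL; rewrite !Nat2N.id => Hc.
case: i nE => [|i] nE.
  rewrite divn1 in nE; rewrite nE => Hn; apply: (ndvd_threshold_sum (geq_minr _ _) Hc (exact_ok _ lM_pend)).
  exact: pdvdW (geq_minl _ _) (threshold_sum_divisible (fact_twosP _) Hn).
have [nz|alive] := boolP (nonzero_mod (c M l) (s * h.+1)).
  exact: box_ndvd (leq_addr _ _) (leqnn _) Hc nz _ _ nE.
have nE' : (n %/ 2 ^ i = M.*2 + odd (n %/ 2 ^ i))%N.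
  by rewrite -nE expnSr divnMA divn2 addnC odd_double_half.
apply: (IHf l _ _ _ i n nE'); last by rewrite l_gt0.
apply/flatten_mapP; exists (l, M); first by rewrite mem_filter alive.
by rewrite !inE /=; case: (odd _); rewrite ?addn0 ?addn1 eqxx ?orbT.
Qed.

Definition big_factors (s k : N) : option (N * N) := Some (power 9 k s, 1%num).

Definition starts (L : nat) : seq (nat * nat) :=
  flatten [seq [seq (l, M) | M <- iota l l] | l <- iota 1 L].

(** An even harmonic sum at [n = 1] would give [threshold_sum] a single factor 2; from
    [n = 2] on, [n`! ^ s] contributes nine more when [s >= 9]. *)
Definition big_precision (M : nat) : nat := if M is 1 then 1 else 9.

Definition big_exponents (L : nat) : bool :=
  all (fun i =>
    if table_of_sums (big_factors (N.of_nat (9 + i))) 9 L (2 * L) is Some c then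
      all (fun x => nonzero_mod (c x.2 x.1) (big_precision x.2)) (starts L)
    else false) (iota 0 (2 ^ 8)).

Definition small_exponents (L : nat) : bool :=
  all (fun s => sweep 8 s 0 L (starts L)) (iota 2 7).

Lemma mem_starts L l M : (0 < l <= L)%N -> (l <= M < 2 * l)%N -> (l, M) \in starts L.
Proof.
move=> le_l le_M; apply/flatten_mapP; exists l; first by rewrite mem_iota; lia.
by apply/mapP; exists M => //; rewrite mem_iota; lia.
Qed.

(** For odd [k] by Euler's theorem; for even [k] both powers vanish. *)
Lemma expn_mod_periodic e k s : (e <= s)%N ->
  k ^ s = k ^ (e + (s - e) %% 2 ^ e.-1) %[mod 2 ^ e].
Proof.
case: e => [|e] le_es; first by rewrite expn0 !modn1.
set q := ((s - e.+1) %/ 2 ^ e)%N; set r := ((s - e.+1) %% 2 ^ e)%N.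
have -> : s = (e.+1 + r + 2 ^ e * q)%N.
  by rewrite -addnA [(r + _)%N]addnC mulnC -divn_eq subnKC.
have [ok|ek] := boolP (odd k); last first.
  have dv x : (e < x)%N -> k ^ x = 0 %[mod 2 ^ e.+1].
    move=> lt_ex; apply/eqP; rewrite mod0n -/(dvdn _ _).
    by apply: (@dvdn_trans (2 ^ x)); rewrite ?dvdn_exp2l // dvdn_exp2r // dvdn2.
  by rewrite !dv // -?addnA addSn ltnS leq_addr.
have ck : coprime k (2 ^ e.+1) by rewrite coprimeXr // coprimen2.
rewrite expnD expnM -modnMmr -modnXm.
have -> : k ^ (2 ^ e) = 1 %[mod 2 ^ e.+1].
  by have := Euler_exp_totient ck; rewrite totient_pfactor // mul1n.
by rewrite modnXm exp1n modnMmr muln1.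
Qed.

Lemma big_factorsP s r : (forall k, k ^ s = k ^ r %[mod 2 ^ 9]) ->
  factors_ok s 9 0 (big_factors (N.of_nat r)).
Proof.
move=> E k a b [<- <-]; split; last first.
  by rewrite tail_dvd ?expn0 ?dvd1n // subrr; apply: pdvd0.
rewrite /lead expn0 dvd1n divn1; apply: (@pdvd_trans _ _ _ (k.+1 ^ r)%:R).
  rewrite (divn_eq (k.+1 ^ s) (2 ^ 9)) E {2}(divn_eq (k.+1 ^ r) (2 ^ 9)) !natrD opprD addrACA subrr addr0.
  by apply: pdvdB; apply: pdvd_nat; apply: dvdn_mull.
rewrite natrX -[r in X in pdvd _ (X - _)]Nat2N.id; apply: powerP; first exact: pdvd_int.
suff : pdvd 9 (k.+1%:R - (N.of_nat k.+1)%:rat) by [].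
by rewrite Nat2N.id subrr; apply: pdvd0.
Qed.

Lemma big_exponentsP L s l n : big_exponents L -> (9 <= s)%N -> (0 < l <= L)%N ->
  forall i M, (n %/ 2 ^ i = M)%N -> (l <= M < 2 * l)%N -> ~ pdvd 1 (harmonic s l n).
Proof.
move=> /allP big le_9s le_l i M nE le_M.
have /big : ((s - 9) %% 2 ^ 8 \in iota 0 (2 ^ 8))%N by rewrite mem_iota ltn_mod.
case Ec: table_of_sums => [c|] // /allP/(_ _ (mem_starts le_l le_M)) /= nz.
have fac_ok := big_factorsP (fun k => @expn_mod_periodic 9 k s le_9s).
have Hc : pdvd 9 (threshold_sum s 0 M l - (c M l)%:rat).
  by apply: (table_of_sumsP fac_ok Ec); lia.
set f := big_precision M in nz; have le_f9 : (f <= 9)%N by rewrite /f; case: (M) => [|[]].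
case: i nE => [|i] nE.
  rewrite divn1 in nE; rewrite nE => Hn; apply: (ndvd_threshold_sum le_f9 Hc nz).
  case: (ltngtP M 1) => [||M1].
  - lia.
  - move=> lt_1M; apply: pdvdW (@threshold_sum_divisible _ _ _ _ 1 _ Hn); first by rewrite muln1; lia.
    by rewrite divn1; apply: dvdn_fact.
  - apply: pdvdW (@threshold_sum_divisible _ _ _ _ 0 (dvd1n _) Hn).
    by rewrite /f M1 !mul0n muln0.
apply: (box_ndvd _ le_f9 _ Hc nz nE); lia.
Qed.

(** Dropping binary digits of [n], an integer between [l] and [2 * l] is reached. *)
Theorem equal_exponents_odd L s l n : big_exponents L -> small_exponents L ->
  (2 <= s)%N -> (0 < l <= L)%N -> (l <= n)%N -> ~ pdvd 1 (harmonic s l n).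
Proof.
move=> big small le_2s le_l le_ln; have l_gt0 : (0 < l)%N by lia.
have q_gt0 : (0 < n %/ l)%N by rewrite divn_gt0.
have /andP[lo hi] := trunc_log_bounds (isT : 1 < 2)%N q_gt0; set i := trunc_log 2 _ in lo hi.
have le_M : (l <= n %/ 2 ^ i < 2 * l)%N.
  rewrite leq_divRL ?expn_gt0 // mulnC -leq_divRL // lo /=.
  by rewrite ltn_divLR ?expn_gt0 // mulnAC -expnS -ltn_divLR.
case: (leqP 9 s) => [le_9s|lt_s9]; first exact: (big_exponentsP big le_9s le_l erefl le_M).
have /(allP small)/sweepP : s \in iota 2 7 by rewrite mem_iota; lia.
by move/(_ _ _ (mem_starts le_l le_M) le_l i n); apply.
Qed.
End EqualExponentsSearch.

(** * From certificates to finiteness *)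

Local Open Scope classical_set_scope.

Lemma divisible_setP s p n : prime p -> (0 < size s)%N -> divisible_set s p n ->
  n = 0%N \/ [/\ (0 < n)%N, (size s <= n)%N & pdvd p 1 (hsum (fun k => k%:R^-1) (rev s) n)].
Proof.
move=> p_pr s_gt0 [->|[le_n dv]]; first by left.
by right; split=> //; [exact: leq_trans le_n | rewrite -mhs_hsum; apply: pdvd_numq].
Qed.

(** What [certifyP] asks of the tables; it holds for all the data that are built below. *)
Record sound (E : data) : Prop := Sound {
  radix_prime : prime (N.to_nat (radix E));
  units_sound : units_ok (radix E) (units E);
  tables_sound : forall s, table_ok (N.to_nat (radix E)) s (nth no_table (tables E) s);
  rpow_sound : forall c, rpow E c = (radix E ^ c)%num }.

Lemma certify_ndvd E s sg n : sound E -> map N.to_nat sg = rev s -> certify E sg ->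
  (size s <= n)%N -> (0 < n)%N ->
  let T := trunc_log (N.to_nat (radix E)) n in
  (N.to_nat (cap E) <= T)%N -> (exact E -> T = N.to_nat (cap E)) ->
  ~ pdvd (N.to_nat (radix E)) 1 (hsum (fun k => k%:R^-1) (rev s) n).
Proof.
move=> [p_pr uE tE rE] sE cert le_n n_gt0 T le_DT eqT; rewrite -sE.
apply: (certifyP p_pr uE tE rE le_DT eqT cert); last by rewrite -(size_map N.to_nat) sE size_rev.
exact: trunc_log_bounds (prime_gt1 p_pr) n_gt0.
Qed.

Lemma finite_divisible_set E s sg p : sound E -> N.to_nat (radix E) = p -> exact E = false ->
  (0 < size s)%N -> map N.to_nat sg = rev s -> certify E sg -> finite_set (divisible_set s p).
Proof.
move=> sE <- exE s_gt0 sgE cert; have p_pr := radix_prime sE; set p' := N.to_nat _ in p_pr *.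
apply: (@sub_finite_set _ _ `I_(p' ^ N.to_nat (cap E)).+1); last exact: finite_II.
move=> n /(divisible_setP p_pr s_gt0)[-> //|[n_gt0 le_n dv]] /=.
rewrite ltnS leqNgt; apply/negP => lt_n.
apply: (certify_ndvd sE sgE cert le_n n_gt0) dv; last by rewrite exE.
by rewrite -(trunc_expnK (N.to_nat (cap E)) (prime_gt1 p_pr)) leq_trunc_log // ltnW.
Qed.

(** The general search covers [T >= D], and one search with [exact = true] is needed for
    each smaller [T]. *)
Lemma trivial_divisible_set (env : bool -> N -> data) s sg D p :
  (forall ex T, [/\ sound (env ex T), N.to_nat (radix (env ex T)) = p,
                    exact (env ex T) = ex & cap (env ex T) = T]) ->
  (0 < size s)%N -> map N.to_nat sg = rev s ->
  certify (env false D) sg -> (forall T, (T < N.to_nat D)%N -> certify (env true (N.of_nat T)) sg) ->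
  divisible_set s p = [set 0%N].
Proof.
move=> envE s_gt0 sgE certD cert.
have [sD pE _ _] := envE false D; have p_pr := radix_prime sD; rewrite pE in p_pr.
apply/seteqP; split=> [n|n ->]; last by left.
case/(divisible_setP p_pr s_gt0) => // -[n_gt0 le_n dv]; exfalso; move: dv.
case: (ltnP (trunc_log p n) (N.to_nat D)) => [lt_D|le_D].
  have [sT pT exT capT] := envE true (N.of_nat (trunc_log p n)).
  rewrite -[in pdvd p]pT; apply: (certify_ndvd sT sgE (cert _ lt_D) le_n n_gt0);
    by rewrite capT Nat2N.id pT.
have [_ _ exD capD] := envE false D.
by rewrite -[in pdvd p]pE; apply: (certify_ndvd sD sgE certD le_n n_gt0); rewrite ?capD ?pE ?exD.
Qed.

(** * The computations *)

Definition search_data (p : N) (es hi : seq N) (n bits : nat) (a : N -> N) : bool -> N -> data :=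
  let u := units_for p es hi n bits in
  let t := tables_for p u n a in
  let r := memo 8 (fun i => (p ^ i)%num) in
  fun ex D => Data p D ex u t r.

Lemma search_data_sound p es hi n bits a ex D : prime (N.to_nat p) ->
  sound (search_data p es hi n bits a ex D).
Proof.
move=> p_pr; have uE : units_ok p (units_for p es hi n bits) by apply: units_forP.
by split=> //= [s|c]; [exact: tables_forP | exact: memoE].
Qed.

Definition families (test : seq N -> bool) : bool :=
  let ex a b f := all (fun i => f (N.of_nat i)) (iota a b) in
  [&& ex 1 20 (fun s => ex 2 19 (fun t => test [:: t; s])),
      ex 1 10 (fun r => ex 1 10 (fun s => ex 2 9 (fun t => test [:: t; s; r]))) &
      ex 1 4 (fun q => ex 1 4 (fun r => ex 1 4 (fun s => ex 2 3 (fun t => test [:: t; s; r; q]))))].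

Definition in_families (s : seq nat) : bool :=
  match s with
  | [:: s; t] => (1 <= s <= 20) && (2 <= t <= 20)
  | [:: r; s; t] => [&& 1 <= r <= 10, 1 <= s <= 10 & 2 <= t <= 10]
  | [:: q; r; s; t] => [&& 1 <= q <= 4, 1 <= r <= 4, 1 <= s <= 4 & 2 <= t <= 4]
  | _ => false
  end%N.

Lemma familiesP test s : families test -> in_families s -> test (map N.of_nat (rev s)).
Proof.
have exP a b (f : pred nat) i : all f (iota a b) -> (a <= i < a + b)%N -> f i.
  by move=> /allP H lt_i; apply: H; rewrite mem_iota.
case/and3P=> f2 f3 f4; case: s => [|q [|r [|s [|t [|? ?]]]]] //=; rewrite /rev /=.
- case/andP=> hq hr.
  exact: (exP _ _ _ r (exP _ _ _ q f2 hq) hr).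
- case/and3P=> hq hr hs.
  exact: (exP _ _ _ s (exP _ _ _ r (exP _ _ _ q f3 hq) hr) hs).
case/and4P=> hq hr hs ht.
exact: (exP _ _ _ t (exP _ _ _ s (exP _ _ _ r (exP _ _ _ q f4 hq) hr) hs) ht).
Qed.

Lemma to_nat_of_nat s : map N.to_nat (map N.of_nat s) = s.
Proof. by rewrite -map_comp (eq_map Nat2N.id) map_id. Qed.

(** A small [D] is preferable, as the searches for all [T < D] have to be run as well; so
    the candidates in [caps] are tried in turn.  The conditional, unlike a boolean
    connective, keeps call-by-value evaluation from trying the remaining ones. *)
Fixpoint trivial_at (env : bool -> N -> data) (caps : seq N) (sg : seq N) : bool :=
  if caps is D :: caps' then
    if certify (env false D) sg then
      all (fun T => certify (env true (N.of_nat T)) sg) (iota 0 (N.to_nat D))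
    else trivial_at env caps' sg
  else false.

Lemma trivial_atP env caps sg : trivial_at env caps sg -> exists2 D,
  certify (env false D) sg & forall T, (T < N.to_nat D)%N -> certify (env true (N.of_nat T)) sg.
Proof.
elim: caps => [|D caps IHc]; first by [].
cbn [trivial_at]; case: ifP => [cD|_]; last exact: IHc.
(* Each goal gets its own hypothesis, since comparing two different searches would mean
   to evaluate them. *)
move=> /allP cT; exists D; first exact: cD.
by move=> T lt_T; apply: cT; rewrite mem_iota.
Qed.

(** The sizes of the tables are a compromise: larger tables take longer to compute, but
    permit larger steps.  Sums with exponent 1 converge slowest and get finer tables at
    the primes 2 and 3. *)
Definition search5 := search_data 5 [:: 4; 8; 12]%num [:: 4; 8; 12; 16; 20]%num 10 11 (fun=> 3%num).
Definition search3 := search_data 3 [:: 5; 10]%num [:: 5; 10; 20]%num 10 10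
  (fun s => if (s =? 1)%num then 7%num else 5%num).
Definition search2 := search_data 2 [:: 8; 16]%num [:: 8; 16; 32]%num 10 10
  (fun s => if (s =? 1)%num then 11%num else if (s <=? 4)%num then 7%num else 5%num).
Definition small_search (p a : N) := 
  search_data p [:: 2; 4]%num [:: 2; 4; 8]%num 5 10 (fun=> a) false 12.

Definition caps2 : seq N := [:: 2; 3; 5; 8; 13; 20]%num.

Definition small_cases : bool :=
  [&& certify (small_search 3 4) [:: 1; 1]%num, certify (small_search 3 4) [:: 1; 1; 1]%num,
      certify (small_search 7 2) [:: 1; 1]%num, certify (small_search 7 2) [:: 2; 1; 1]%num,
      certify (small_search 13 1) [:: 1; 1]%num, certify (small_search 31 1) [:: 1; 1]%num,
      certify (small_search 17 1) [:: 5; 3; 4]%num & certify (small_search 17 1) [:: 4; 3; 5]%num].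

Lemma small_cases_certified : small_cases = true.
Proof. by vm_cast_no_check (erefl true). Qed.

Lemma families5_certified : families (certify (search5 false 20)) = true.
Proof. by vm_cast_no_check (erefl true). Qed.

Lemma families3_certified : families (certify (search3 false 20)) = true.
Proof. by vm_cast_no_check (erefl true). Qed.

Lemma families2_certified : families (trivial_at search2 caps2) = true.
Proof. by vm_cast_no_check (erefl true). Qed.

Lemma equal_exponents_certified : big_exponents 20 && small_exponents 20 = true.
Proof. by vm_cast_no_check (erefl true). Qed.

Lemma divisible_set_families2 s : in_families s -> divisible_set s 2 = [set 0%N].
Proof.
move=> fam; have [D cD cT] := trivial_atP (familiesP families2_certified fam).
apply: (@trivial_divisible_set search2 s _ D 2 _ _ _ cD cT) => [ex T||].
- by split=> //; apply: search_data_sound.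
- by case: s fam {cD cT}.
by rewrite to_nat_of_nat.
Qed.

Lemma finite_families s p : in_families s -> p \in [:: 2; 3; 5]%N -> finite_set (divisible_set s p).
Proof.
move=> fam; have s_gt0 : (0 < size s)%N by case: s fam.
have sgE := to_nat_of_nat (rev s).
rewrite !inE => /or3P[] /eqP->.
- by rewrite divisible_set_families2 //; apply: finite_set1.
- by apply: (finite_divisible_set (search_data_sound _ _ _ _ _ _ _ _) _ _ s_gt0 sgE
                 (familiesP families3_certified fam)).
- by apply: (finite_divisible_set (search_data_sound _ _ _ _ _ _ _ _) _ _ s_gt0 sgE
                 (familiesP families5_certified fam)).
Qed.

Lemma divisible_set_nseq s l : (1 <= l <= 20)%N -> (2 <= s)%N -> divisible_set (nseq l s) 2 = [set 0%N].
Proof.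
move=> le_l le_s; have s_gt0 : (0 < size (nseq l s))%N by rewrite size_nseq; case/andP: le_l.
apply/seteqP; split=> [n|n ->]; last by left.
case/(divisible_setP (isT : prime 2) s_gt0) => // -[_ le_n dv]; exfalso.
rewrite size_nseq in le_n; rewrite rev_nseq in dv.
have /andP[big small] := equal_exponents_certified.
exact: equal_exponents_odd big small le_s le_l le_n dv.
Qed.

Lemma finite_small_case p a s sg : prime (N.to_nat p) -> certify (small_search p a) sg ->
  (0 < size s)%N -> map N.to_nat sg = rev s -> finite_set (divisible_set s (N.to_nat p)).
Proof.
move=> p_pr cert s_gt0 sgE.
by apply: (finite_divisible_set (search_data_sound _ _ _ _ _ _ _ p_pr) _ _ s_gt0 sgE cert).
Qed.

Local Open Scope classical_set_scope.
Local Open Scope nat_scope.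
Theorem theorem1p3 :
  ((forall p : nat, p \in [:: 3; 7; 13; 31] ->
      finite_set (divisible_set [:: 1; 1] p)) /\
   finite_set (divisible_set [:: 1; 1; 1] 3) /\
   finite_set (divisible_set [:: 1; 1; 2] 7)) /\
  (finite_set (divisible_set [:: 4; 3; 5] 17) /\
   finite_set (divisible_set [:: 5; 3; 4] 17)) /\
  (forall s l : nat, 1 <= l <= 20 -> 2 <= s ->
     finite_set (divisible_set (nseq l s) 2)) /\
  (forall s t p : nat, 1 <= s <= 20 -> 2 <= t <= 20 -> p \in [:: 2; 3; 5] ->
     finite_set (divisible_set [:: s; t] p)) /\
  (forall r s t p : nat, 1 <= r <= 10 -> 1 <= s <= 10 -> 2 <= t <= 10 ->
     p \in [:: 2; 3; 5] ->
     finite_set (divisible_set [:: r; s; t] p)) /\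
  (forall q r s t p : nat, 1 <= q <= 4 -> 1 <= r <= 4 -> 1 <= s <= 4 ->
     2 <= t <= 4 -> p \in [:: 2; 3; 5] ->
     finite_set (divisible_set [:: q; r; s; t] p)) /\
  ((forall s l : nat, 1 <= l <= 20 -> 2 <= s ->
      divisible_set (nseq l s) 2 = [set 0]) /\
   (forall s t : nat, 1 <= s <= 20 -> 2 <= t <= 20 ->
      divisible_set [:: s; t] 2 = [set 0]) /\
   (forall r s t : nat, 1 <= r <= 10 -> 1 <= s <= 10 -> 2 <= t <= 10 ->
      divisible_set [:: r; s; t] 2 = [set 0]) /\
   (forall q r s t : nat, 1 <= q <= 4 -> 1 <= r <= 4 -> 1 <= s <= 4 ->
      2 <= t <= 4 ->
      divisible_set [:: q; r; s; t] 2 = [set 0])).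

Proof.

have := small_cases_certified; rewrite /small_cases.
case/and5P=> c3 c3' c7 c7' /and4P[c13 c31 c17 c17'].
split; [split; [|split] | split; [split | ]].
- move=> p; rewrite !inE => /or4P[] /eqP->.
  + exact (@finite_small_case 3%num 4%num [:: 1; 1] _ isT c3 isT erefl).
  + exact (@finite_small_case 7%num 2%num [:: 1; 1] _ isT c7 isT erefl).
  + exact (@finite_small_case 13%num 1%num [:: 1; 1] _ isT c13 isT erefl).
  + exact (@finite_small_case 31%num 1%num [:: 1; 1] _ isT c31 isT erefl).
- exact (@finite_small_case 3%num 4%num [:: 1; 1; 1] _ isT c3' isT erefl).
- exact (@finite_small_case 7%num 2%num [:: 1; 1; 2] _ isT c7' isT erefl).
- exact (@finite_small_case 17%num 1%num [:: 4; 3; 5] _ isT c17 isT erefl).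
- exact (@finite_small_case 17%num 1%num [:: 5; 3; 4] _ isT c17' isT erefl).
(* Left in the context, these would be compared with later goals by evaluation. *)
clear c3 c3' c7 c7' c13 c31 c17 c17'.
split; first by move=> s l le_l le_s; rewrite divisible_set_nseq //; apply: finite_set1.
split; first by move=> s t p hs ht; apply: finite_families; rewrite /in_families hs ht.
split; first by move=> r s t p hr hs ht; apply: finite_families; rewrite /in_families hr hs ht.
split; first by move=> q r s t p hq hr hs ht; apply: finite_families; rewrite /in_families hq hr hs ht.
split; first exact: (fun s l => @divisible_set_nseq s l).
split; first by move=> s t hs ht; apply: divisible_set_families2; rewrite /in_families hs ht.
split; first by move=> r s t hr hs ht; apply: divisible_set_families2; rewrite /in_families hr hs ht.
by move=> q r s t hq hr hs ht; apply: divisible_set_families2; rewrite /in_families hq hr hs ht.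
Qed.
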